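(* Let $G=((V,\mathcal A,\mu),E)$ be a measurable graph such that $(V,\mathcal A,\mu)$ is a finite, countably generated measure space. If $\alpha(G)>0$ and $E$ is thick, then $$\alpha(G)=\lim_{r\to\infty}\vartheta(G,C_r(V)^* ).$$
   Context: All functions and measures are real valued. A measure space is countably generated if its $\sigma$-algebra is. A measurable graph is a graph with vertex set $V$ whose edge set $E$, viewed as the symmetric set $\{(x,y)\in V^2: xy \text{ an edge}\}$ (no loops), is measurable in $V^2$. A set is independent if it contains no edge, and $\alpha(G)=\sup\{\mu(I):I\subseteq V\text{ measurable and independent}\}$. $L^2_{\mathrm{sym}}(V)$ is the space of symmetric square-integrable kernels on $V^2$ with $\langle F,G\rangle=\int FG\,d\mu^2$; $J$ is the constant kernel $1$. For $r\in\mathbb N=\{0,1,\dots\}$ and $K\in L^2_{\mathrm{sym}}(V)$ let $\mathcal T_rK(v_1,\dots,v_{r+2})=\frac1{(r+2)!}\sum_{\pi\in\mathfrak S_{r+2}}K(v_{\pi(1)},v_{\pi(2)})$, let $C_r(V)=\{K\in L^2_{\mathrm{sym}}(V):\mathcal T_rK\ge0\text{ a.e.}\}$, and let $C_r(V)^*$ be its dual cone in $L^2_{\mathrm{sym}}(V)$. For a convex cone $\mathcal C\subseteq L^2_{\mathrm{sym}}(V)$, $\vartheta(G,\mathcal C)$ is the supremum of $\langle A,J\rangle$ over all positive-semidefinite kernels $A\in\mathcal C$ (i.e. $\langle A,f\otimes f\rangle\ge0$ for all $f\in L^2(V)$) that are trace class with $\mathrm{Tr}(A)=1$ and satisfy $A(x,y)=0$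 for all $xy\in E$ (i.e. the class $A$ has a representative vanishing on $E$). Thick sets: let $\mathcal A^+$ be the family of measurable sets of nonzero measure. Let $\mathcal D\subseteq\mathcal A^+$ be such that for each $v$ the sets $D\in\mathcal D$ containing $v$ are directed by reverse inclusion. For $A\in\mathcal A^+$, let $D(A)$ be the set of $v\in V$ with $\lim_{v\in D\in\mathcal D}\mu(D\cap A)/\mu(D)=1$. $\mathcal D$ is a density system if $\mu(A\,\triangle\,D(A))=0$ for all $A\in\mathcal A^+$. $E\subseteq V^2$ is $\mathcal D$-thick if for all $(v_1,v_2)\in E$, $$\lim_{D_1,D_2\in\mathcal D,\ v_i\in D_i}\frac{\mu^2((D_1\times D_2)\cap E)}{\mu(D_1)\mu(D_2)}>0,$$ and thick if it is $\mathcal D$-thick for some density system $\mathcal D$. *)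

(* Defs.v *)
From HB Require Import structures.
From mathcomp Require Import all_boot all_order all_algebra all_fingroup.
From mathcomp Require Import all_classical all_reals all_analysis.
Import Order.TTheory GRing.Theory Num.Theory.
Import numFieldNormedType.Exports.

Set Implicit Arguments.
Unset Strict Implicit.
Unset Printing Implicit Defensive.

Local Open Scope classical_set_scope.
Local Open Scope ring_scope.

Definition countably_generated d (V : measurableType d) :=
  exists2 F : set (set V), countable F & @measurable d V = <<s F >>.

Section graph.
Context d (V : measurableType d) (R : realType).
Variable mu : {finite_measure set V -> \bar R}.
Implicit Types (E : set (V * V)) (I : set V).

Definition measurable_graph E :=
  [/\ measurable E, forall x y, E (x, y) -> E (y, x) & forall x, ~ E (x, x)].

Definition independent_set E I := forall x y, I x -> I y -> ~ E (x, y).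

Definition independence_number E : \bar R :=
  ereal_sup [set mu I | I in [set I | measurable I /\ independent_set E I]].

End graph.

(* The n-fold product measure; for n = 0 it is the unit mass on the empty
   tuple.  As product_measure1, it is given as a bare set function. *)
Fixpoint power_measure d (V : measurableType d) (R : realType)
    (mu : {finite_measure set V -> \bar R}) (n : nat) :
    set (n.-tuple V) -> \bar R :=
  match n with
  | 0%N => \d_ [tuple]
  | m.+1 => pushforward (product_measure1 mu (@power_measure d V R mu m))
              (fun p : V * m.-tuple V => [tuple of p.1 :: p.2])
  end.

Section kernels.
Context d (V : measurableType d) (R : realType).
Variable mu : {finite_measure set V -> \bar R}.
Local Notation mu2 := (mu \x mu)%E.
Implicit Types (f g : V -> R) (A K F G : V * V -> R) (C : set (V * V -> R)).

(* Elements of L^2 are handled through representatives; every notion below is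
   invariant under almost everywhere equality. *)
Definition inner f g : R := \int[mu]_x (f x * g x).

Definition inner2 F G : R := \int[mu2]_p (F p * G p).

Definition tensor f g : V * V -> R := fun p => f p.1 * g p.2.

Definition L2sym : set (V * V -> R) :=
  [set K | K \in Lfun mu2 2%:E /\ {ae mu2, forall p, K p = K (p.2, p.1)}].

Definition T_op (r : nat) K (v : r.+2.-tuple V) : R :=
  (r.+2`!%:R)^-1 * \sum_(s : 'S_r.+2) K (tnth v (s 0), tnth v (s 1)).

Definition C_cone (r : nat) : set (V * V -> R) :=
  [set K | L2sym K /\ {ae @power_measure d V R mu r.+2, forall v, 0 <= T_op K v}].

Definition dual_cone C : set (V * V -> R) :=
  [set A | L2sym A /\ forall K, C K -> 0 <= inner2 A K].

Definition psd A :=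
  forall f, f \in Lfun mu 2%:E -> 0 <= inner2 A (tensor f f).

Definition orthonormal_basis (I : choiceType) (e : I -> V -> R) :=
  [/\ forall i, e i \in Lfun mu 2%:E,
      forall i j, inner (e i) (e j) = (i == j)%:R
    & forall f, f \in Lfun mu 2%:E -> (forall i, inner f (e i) = 0) ->
        {ae mu, forall x, f x = 0}].

(* For a positive-semidefinite A: the operator f |-> \int A(., y) f(y) dy is
   trace class with trace t.  Since |A| = A, this says that the nonnegative
   series of the diagonal coefficients <A e_i, e_i> = <A, e_i (x) e_i> in an
   orthonormal basis sums to t; the value does not depend on the basis. *)
Definition trace_class_with_trace A (t : R) :=
  exists (I : choiceType) (e : I -> V -> R), orthonormal_basis e /\
    \esum_(i in [set: I]) (inner2 A (tensor (e i) (e i)))%:E = t%:E.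

Definition theta_feasible (E : set (V * V)) C A :=
  [/\ C A, psd A, trace_class_with_trace A 1
    & exists2 B : V * V -> R, {ae mu2, forall p, A p = B p}
        & forall p, E p -> B p = 0].

Definition theta (E : set (V * V)) C : \bar R :=
  ereal_sup [set (inner2 A (cst 1))%:E | A in theta_feasible E C].

End kernels.

Section thickness.
Context d (V : measurableType d) (R : realType).
Variable mu : {finite_measure set V -> \bar R}.
Implicit Types (DD : set (set V)) (E : set (V * V)).

Definition nonnull : set (set V) :=
  [set A | measurable A /\ mu A != 0%E].

Definition members_at DD (v : V) : set (set V) := DD `&` [set D | D v].

Definition directed_at DD (v : V) :=
  members_at DD v !=set0 /\
  forall D1 D2, members_at DD v D1 -> members_at DD v D2 ->
    exists2 D3, members_at DD v D3 & D3 `<=` D1 `&` D2.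

(* The filter of tails of the net (D)_(v in D in DD). *)
Definition shrinking DD (v : V) : set_system (set V) :=
  filter_from (members_at DD v)
    (fun D0 => members_at DD v `&` [set D | D `<=` D0]).

Definition density_points DD (A : set V) : set V :=
  [set v | (fun D => fine (mu (D `&` A)) / fine (mu D)) @ shrinking DD v
             --> (1 : R)].

Definition density_system DD :=
  [/\ DD `<=` nonnull, forall v, directed_at DD v
    & forall A, nonnull A ->
        mu.-negligible ((A `\` density_points DD A) `|`
                        (density_points DD A `\` A))].

Definition thick_wrt DD E :=
  forall v1 v2, E (v1, v2) -> exists2 l : R, 0 < l &
    (fun D : set V * set V =>
       fine ((mu \x mu)%E ((D.1 `*` D.2) `&` E)) / (fine (mu D.1) * fine (mu D.2)))
      @ filter_prod (shrinking DD v1) (shrinking DD v2) --> l.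

Definition thick E := exists2 DD, density_system DD & thick_wrt DD E.

End thickness.

(* Main.v *)
From HB Require Import structures.
Require Import Defs.
From mathcomp Require Import all_boot all_order all_algebra all_fingroup finmap.
From mathcomp Require Import all_classical all_reals all_analysis.
From mathcomp Require Import measurable_realfun ring lra.
Import Order.TTheory GRing.Theory Num.Theory.
Import numFieldNormedType.Exports.
Local Open Scope classical_set_scope.
Local Open Scope ring_scope.

(** Write alpha for the independence number, mu2 for the square of mu, and J
    for the constant kernel 1.

    Lower bound.  If I is measurable, independent and of positive measure, the
    kernel 1_I (x) 1_I / mu(I) is feasible for every r and has value mu(I).  Its
    trace is read off in an orthonormal basis containing the normalized
    indicator of I, where one diagonal coefficient is 1 and the others vanish
    (orthonormal_basis_extension).  It pairs nonnegatively with every K in C_r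
    because the integral of T_r K over I^(r+2) is a positive multiple of the
    integral of K over I x I (C_cone_square_ge0).

    Upper bound.  For real numbers alpha < l < lam an explicit certificate shows
    that all feasible A have <A, J> <= lam once r is large.  It is the kernel

      K = l Z - J + M W,   Z = sum_k 1_{P_k} (x) 1_{P_k} / mu(P_k),

    for a finite measurable partition (P_k) of V and the indicator W of a union
    of rectangles P_k x P_l that is L2-close to the edge set E.  Three facts are
    combined.
    - <A, Z> <= Tr A = 1, since the normalized indicators of the cells are
      orthonormal (trace_cells).
    - <A, W> is small: A is orthogonal to 1_E, and |<A, F>| <= ||F|| for the
      differences F = 1_E - W (indicator_kernel_bound), again by the bound on
      the trace.
    - K belongs to C_r for large r (certificate_C_cone).  As K depends only on
      the cells of its arguments, the sum of K over all pairs among r+2 points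
      is (r+2)^2 (l ||f||^2 - 1 + M <W, f (x) f>), where f is the probability
      density, constant on cells, that charges the cells as the sample does.
      Omitting the diagonal pairs costs a term of order r+2, so it is enough
      that the form in f is bounded below by a positive constant.

    The last point is a coercivity statement about E alone (coercivity): for
    l' > alpha there is M such that l' ||f||^2 + M <1_E, f (x) f> >= 1 for every
    probability density f in L2.  If it failed for all M, a weak limit g of
    counterexamples would be supported on a set S with mu(S) >= l' and
    mu2(E n S x S) = 0 (weak_ultralimit, edge_energy_eq0).  Thickness forbids
    edges between density points of S, so S contains an independent
    set of the same measure, which is greater than alpha.

    The order of the choices matters: M depends on E only, the partition is then
    chosen so fine that W is close to E relative to 1/M, and r comes last.
    W is compared with E in L2 and not pointwise: E need not contain any
    rectangle of positive measure. *)

Set Implicit Arguments.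
Unset Strict Implicit.
Unset Printing Implicit Defensive.

(** * Square-integrable functions *)

Lemma discriminant_le0 (R : realFieldType) (a b c : R) : 0 <= c ->
  (forall t, 0 <= a - 2 * t * b + t ^+ 2 * c) -> b ^+ 2 <= a * c.
Proof.
rewrite le_eqVlt => /predU1P[<- H|c0 H].
  rewrite mulr0; have [->|b0] := eqVneq b 0; first by rewrite expr0n.
  have := H ((a + 1) / (2 * b)).
  by rewrite mulr0 addr0 (_ : 2 * _ * b = a + 1); [lra|field].
have := H (b / c).
have -> : a - 2 * (b / c) * b + (b / c) ^+ 2 * c = a - b ^+ 2 / c.
  by field; rewrite gt_eqF.
by rewrite subr_ge0 ler_pdivrMr.
Qed.

Section L2.
Context d (T : measurableType d) (R : realType).
Variable m : {measure set T -> \bar R}.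
Local Notation L2 := (Lfun m 2%:E).
Implicit Types f g h : T -> R.

Definition ip f g : R := \int[m]_x (f x * g x).

Lemma L2_measurable f : f \in L2 -> measurable_fun setT f.
Proof. by rewrite inE => /andP[/[!inE]]. Qed.

Lemma L2_mul_integrable f g : f \in L2 -> g \in L2 ->
  m.-integrable setT (EFin \o (f \* g)).
Proof. by move=> f2 g2; apply/Lfun1_integrable/Lfun2_mul_Lfun1. Qed.

Lemma L2I f : measurable_fun setT f ->
  m.-integrable setT (EFin \o (fun x => f x ^+ 2)) -> f \in L2.
Proof.
move=> mf /integrableP[_ intf]; rewrite inE; apply/andP; split; rewrite inE//=.
rewrite /finite_norm unlock poweR_lty//; apply: le_lt_trans intf.
apply: ge0_le_integral => //.
- by move=> x _; rewrite lee_fin powR_ge0.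
- apply/measurable_EFinP.
  by apply: (@measurableT_comp _ _ _ _ _ _ (@powR R ^~ 2)) => //; exact: measurableT_comp.
- by apply/measurable_EFinP; apply: measurableT_comp => //; exact: measurable_funX.
- by move=> x _/=; rewrite lee_fin powR_mulrn// -normrX.
Qed.

Let L2_submod_closed : submod_closed (Lfun m 2%:E).
Proof. exact: Lfun_submod_closed (lee1n 2). Qed.

Lemma L20 : (0 : T -> R) \in L2.
Proof. by case: L2_submod_closed. Qed.

Lemma L2Z a f : f \in L2 -> a *: f \in L2.
Proof.
by move=> f2; case: L2_submod_closed => ? H; rewrite -[_ *: _]addr0; exact: H.
Qed.

Lemma L2D f g : f \in L2 -> g \in L2 -> f + g \in L2.
Proof.
by move=> f2 g2; case: L2_submod_closed => ? H; rewrite -[f]scale1r; exact: H.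
Qed.

Lemma L2B f g : f \in L2 -> g \in L2 -> f - g \in L2.
Proof. by move=> f2 g2; rewrite -scaleN1r; apply: L2D => //; exact: L2Z. Qed.

Lemma L2_sum (I : Type) (s : seq I) (P : pred I) (e : I -> T -> R) :
  (forall i, e i \in L2) -> \sum_(i <- s | P i) e i \in L2.
Proof.
move=> e2; elim/big_rec : _ => [|i g _ g2]; [exact: L20|exact: L2D].
Qed.

Lemma ipC f g : ip f g = ip g f.
Proof. by apply: eq_Rintegral => x _; rewrite mulrC. Qed.

Lemma ipDl f g h : f \in L2 -> g \in L2 -> h \in L2 ->
  ip (f + g) h = ip f h + ip g h.
Proof.
move=> f2 g2 h2; rewrite /ip -RintegralD//; try exact: L2_mul_integrable.
by apply: eq_Rintegral => x _; rewrite /= fctE mulrDl.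
Qed.

Lemma ipZl a f g : f \in L2 -> g \in L2 -> ip (a *: f) g = a * ip f g.
Proof.
move=> f2 g2; rewrite /ip -RintegralZl//; last exact: L2_mul_integrable.
by apply: eq_Rintegral => x _; rewrite fctE -mulrA.
Qed.

Lemma ip0l g : ip 0 g = 0.
Proof.
by rewrite /ip /Rintegral; under eq_integral do rewrite mul0r; rewrite integral0.
Qed.

Lemma ip_ge0 f : 0 <= ip f f.
Proof. by apply: Rintegral_ge0 => x _; rewrite -expr2 sqr_ge0. Qed.

Lemma L2_lincomb (I : Type) (s : seq I) (P : pred I) (c : I -> R) (e : I -> T -> R) :
  (forall i, e i \in L2) -> \sum_(i <- s | P i) c i *: e i \in L2.
Proof. by move=> e2; apply: L2_sum => i; exact: L2Z. Qed.

Lemma ip_suml (I : Type) (s : seq I) (P : pred I) (c : I -> R) (e : I -> T -> R) g :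
  (forall i, e i \in L2) -> g \in L2 ->
  ip (\sum_(i <- s | P i) c i *: e i) g = \sum_(i <- s | P i) c i * ip (e i) g.
Proof.
move=> e2 g2; elim: s => [|i s IH]; first by rewrite !big_nil ip0l.
rewrite !big_cons; case: ifP => // _; rewrite ipDl//.
- by rewrite ipZl// IH.
- exact: L2Z.
- exact: L2_lincomb.
Qed.

Lemma ipDr f g h : f \in L2 -> g \in L2 -> h \in L2 ->
  ip h (f + g) = ip h f + ip h g.
Proof. by move=> ? ? ?; rewrite !(ipC h) ipDl. Qed.

Lemma ipZr a f g : f \in L2 -> g \in L2 -> ip g (a *: f) = a * ip g f.
Proof. by move=> ? ?; rewrite !(ipC g) ipZl. Qed.

Lemma ipBl f g h : f \in L2 -> g \in L2 -> h \in L2 ->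
  ip (f - g) h = ip f h - ip g h.
Proof. by move=> ? ? ?; rewrite -scaleN1r ipDl ?ipZl ?mulN1r//; exact: L2Z. Qed.

Lemma ipBr f g h : f \in L2 -> g \in L2 -> h \in L2 ->
  ip h (f - g) = ip h f - ip h g.
Proof. by move=> ? ? ?; rewrite !(ipC h) ipBl. Qed.

Lemma ip_sumr (I : Type) (s : seq I) (P : pred I) (c : I -> R) (e : I -> T -> R) g :
  (forall i, e i \in L2) -> g \in L2 ->
  ip g (\sum_(i <- s | P i) c i *: e i) = \sum_(i <- s | P i) c i * ip g (e i).
Proof.
by move=> e2 g2; rewrite ipC ip_suml//; apply: eq_bigr => i _; rewrite ipC.
Qed.

Lemma cauchy_schwarz f g : f \in L2 -> g \in L2 ->
  ip f g ^+ 2 <= ip f f * ip g g.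
Proof.
move=> f2 g2; apply: discriminant_le0 => [|t]; first exact: ip_ge0.
have tg : t *: g \in L2 by exact: L2Z.
have := ip_ge0 (f - t *: g).
rewrite ipBl ?ipBr ?L2B// !ipZl// !ipZr// (ipC g f).
by rewrite (_ : _ - _ = ip f f - 2 * t * ip f g + t ^+ 2 * ip g g)//; ring.
Qed.

Lemma ip_ae f f' g : measurable_fun setT f -> measurable_fun setT f' ->
  measurable_fun setT g ->
  {ae m, forall x, f x = f' x} -> ip f g = ip f' g.
Proof.
move=> mf mf' mg ff'; congr fine; apply: ae_eq_integral => //.
- by apply/measurable_EFinP; exact: measurable_funM.
- by apply/measurable_EFinP; exact: measurable_funM.
- by apply: filterS ff' => x -> _.
Qed.

Lemma ip_eq0 f : f \in L2 -> ip f f = 0 -> {ae m, forall x, f x = 0}.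
Proof.
move=> f2 ff0.
have mf := L2_measurable f2.
have mff : measurable_fun setT (fun x => (f x * f x)%:E).
  by apply/measurable_EFinP; exact: measurable_funM.
have : (\int[m]_x `|(f x * f x)%:E| = 0)%E.
  under eq_integral do rewrite gee0_abs ?lee_fin -?expr2 ?sqr_ge0//.
  have /(integrable_fin_num measurableT) := L2_mul_integrable f2 f2.
  by move=> /fineK <-; rewrite -[RHS]/(0%:E) -ff0.
move/(ae_eq_integral_abs _ measurableT mff); apply: filterS => x /(_ I).
by move=> [] /eqP; rewrite mulf_eq0 orbb => /eqP.
Qed.


Definition nrm f := Num.sqrt (ip f f).

Lemma nrm_ge0 f : 0 <= nrm f. Proof. exact: sqrtr_ge0. Qed.

Lemma nrm_sqr f : nrm f ^+ 2 = ip f f.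
Proof. by rewrite sqr_sqrtr// ip_ge0. Qed.

Lemma ip_le_nrm f g : f \in L2 -> g \in L2 -> `|ip f g| <= nrm f * nrm g.
Proof.
move=> f2 g2; rewrite -ler_sqr ?nnegrE ?mulr_ge0 ?nrm_ge0//.
by rewrite real_normK ?num_real// exprMn !nrm_sqr cauchy_schwarz.
Qed.

Lemma nrmD f g : f \in L2 -> g \in L2 -> nrm (f + g) <= nrm f + nrm g.
Proof.
move=> f2 g2; rewrite -ler_sqr ?nnegrE ?addr_ge0 ?nrm_ge0// nrm_sqr.
rewrite ipDl ?ipDr ?L2D// sqrrD !nrm_sqr (ipC g f).
have := le_trans (ler_norm _) (ip_le_nrm f2 g2); lra.
Qed.

Lemma L2_le f g : measurable_fun setT g -> f \in L2 ->
  (forall x, `|g x| <= `|f x|) -> g \in L2.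
Proof.
move=> mg f2 gf; apply: L2I => //.
apply: le_integrable (Lfun2_integrable_sqr f2) => //.
  by apply/measurable_EFinP; exact: measurable_funX.
by move=> x _; rewrite lee_fin !normrX lerXn2r ?nnegrE ?normr_ge0.
Qed.

End L2.

Section L2_finite.
Context d (T : measurableType d) (R : realType).
Variable m : {finite_measure set T -> \bar R}.
Local Notation L2 := (Lfun m 2%:E).
Implicit Types (f g : T -> R) (B : set T).

Lemma L2_bounded f (M : R) : measurable_fun setT f ->
  (forall x, `|f x| <= M) -> f \in L2.
Proof.
move=> mf fM; apply: (L2_le mf (Lfun_cst m M 2)) => x.
by rewrite (le_trans (fM x))// ler_norm.
Qed.

Lemma L2_indic B : measurable B -> \1_B \in L2.
Proof.
move=> mB; apply: (@L2_bounded _ 1) => [|x]; first exact: measurable_indic.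
by rewrite indicE; case: (_ \in _); rewrite ?normr1 ?normr0.
Qed.

Lemma L2_cst1 : (1 : T -> R) \in L2.
Proof. exact: Lfun_cst. Qed.

Lemma L2_mul_indic f B : measurable B -> f \in L2 -> f * \1_B \in L2.
Proof.
move=> mB f2; apply: (L2_le _ f2) => [|x].
  by apply: measurable_funM; [exact: L2_measurable f2|exact: measurable_indic].
rewrite fctE indicE normrM; case: (_ \in _); rewrite ?normr1 ?normr0 ?mulr1//.
by rewrite mulr0.
Qed.

Lemma ip_indic f B : measurable B -> ip m f \1_B = \int[m]_(x in B) f x.
Proof.
move=> mB; rewrite Rintegral_mkcond; apply: eq_Rintegral => x _.
by rewrite patchE indicE; case: (_ \in _); rewrite ?mulr1 ?mulr0.
Qed.

Lemma ip_indic_indic B C : measurable B -> measurable C ->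
  ip m \1_B \1_C = fine (m (B `&` C)).
Proof.
move=> mB mC; rewrite ip_indic// Rintegral_mkcond -[RHS]mul1r -(Rintegral_cst m)//.
  rewrite [RHS]Rintegral_mkcond; apply: eq_Rintegral => x _.
  rewrite !patchE indicE in_setI.
  by case: (x \in B); case: (x \in C).
exact: measurableI.
Qed.

Lemma cvg_measure_empty (D : nat -> set T) : (forall n, measurable (D n)) ->
  nonincreasing_seq D -> \bigcap_n D n = set0 ->
  fine (m (D n)) @[n --> \oo] --> (0 : R).
Proof.
move=> mD ndD D0; apply: fine_cvg; rewrite -[X in _ --> X](measure0 m) -D0.
apply: nonincreasing_cvg_mu => //; last exact: bigcap_measurable.
by rewrite -ge0_fin_numE ?fin_num_measure.
Qed.

Lemma ip_le_sum f g h : f \in L2 -> g \in L2 -> h \in L2 ->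
  (forall x, f x ^+ 2 <= g x ^+ 2 + h x ^+ 2) -> ip m f f <= ip m g g + ip m h h.
Proof.
move=> f2 g2 h2 fgh; rewrite -RintegralD//; try exact: L2_mul_integrable.
apply: le_Rintegral => //; first exact: L2_mul_integrable.
  exact: (integrableD measurableT (L2_mul_integrable g2 g2) (L2_mul_integrable h2 h2)).
by move=> x _; have := fgh x; rewrite !expr2.
Qed.

End L2_finite.

(** * The Riesz representation theorem on L2 *)

Lemma le_sqr_sqrt (R : realType) (x y : R) : x ^+ 2 <= y -> `|x| <= Num.sqrt y.
Proof.
by move=> xy; rewrite -sqrtr_sqr ler_wsqrtr.
Qed.

Lemma lincombE (T I : Type) (R : realType) (s : seq I) (P : pred I) (c : I -> R)
    (e : I -> T -> R) x :
  (\sum_(i <- s | P i) c i *: e i) x = \sum_(i <- s | P i) c i * e i x.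
Proof. by rewrite fct_sumE. Qed.

Lemma sum_indic_only (T : Type) (I : finType) (R : realType) (c : I -> R)
    (B : I -> set T) i0 x : B i0 x -> (forall i, i != i0 -> x \notin B i) ->
  (\sum_i c i *: \1_(B i)) x = c i0.
Proof.
move=> Bx xB; rewrite lincombE (bigD1 i0) //= indicE mem_set// mulr1.
by rewrite big1 ?addr0// => i /xB/negbTE xBi; rewrite indicE xBi mulr0.
Qed.

(** The cells are the level sets of f along a grid of mesh e. *)
Lemma uniform_step_approx d (T : measurableType d) (R : realType) (f : T -> R)
    (M e : R) : measurable_fun setT f -> (forall x, `|f x| <= M) -> 0 < e ->
  exists n (c : 'I_n -> R) (B : 'I_n -> set T), (forall i, measurable (B i)) /\
    forall x, `|(f - \sum_(i < n) c i *: \1_(B i)) x| <= e.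
Proof.
move=> mf fM e0.
(* Mesh points i * e - M with i < N cover [- M, M]. *)
pose N := (Num.trunc (2 * M / e)).+1.
pose c (i : 'I_N) : R := i%:R * e - M.
pose B (i : 'I_N) := f @^-1` `[c i, c i + e[.
exists N, c, B; split=> [i|x].
  by rewrite /B -[_ @^-1` _]setTI; apply: mf => //; exact: measurable_itv.
have [fM1 fM2] : - M <= f x /\ f x <= M by apply/andP; rewrite -ler_norml.
have h0 : 0 <= (f x + M) / e by apply: divr_ge0; [lra|exact: ltW].
have /andP[t1 t2] := truncn_itv h0.
have i0N : (Num.trunc ((f x + M) / e) < N)%N.
  rewrite /N ltnS; apply: le_truncn; rewrite ler_pM2r ?invr_gt0//; lra.
pose i0 := Ordinal i0N.
move: t1 t2; rewrite ler_pdivlMr// ltr_pdivrMr// => t1.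
rewrite -natr1 => t2.
have Bi0 : B i0 x by rewrite /B/= /c/= in_itv/=; apply/andP; split; lra.
have uniqB i : i != i0 -> x \notin B i.
  move=> ii0; apply/negP; rewrite inE /B/= /c in_itv/= => /andP[h1 h2].
  move/eqP: ii0; apply; apply/val_inj/esym => /=; apply: truncn_def.
  rewrite ler_pdivlMr// ltr_pdivrMr// -natr1; apply/andP; split; lra.
rewrite [X in `|X|](_ : _ = f x - c i0); last first.
  by congr (_ - _); exact: sum_indic_only.
rewrite /c/= ler_norml; apply/andP; split; lra.
Qed.

Lemma integrable_scale d (T : measurableType d) (R : realType)
    (m : {measure set T -> \bar R}) (f : T -> R) (c : R) :
  m.-integrable setT (EFin \o f) -> m.-integrable setT (EFin \o (fun x => c * f x)).
Proof. by move=> intf; exact: (integrableZl measurableT c intf). Qed.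

Lemma Rintegral_sum d (T : measurableType d) (R : realType)
    (m : {measure set T -> \bar R}) (I : Type) (s : seq I) (P : pred I)
    (f : I -> T -> R) : (forall i, m.-integrable setT (EFin \o f i)) ->
  \int[m]_x (\sum_(i <- s | P i) f i x) = \sum_(i <- s | P i) \int[m]_x f i x.
Proof.
move=> intf; have intS t : m.-integrable setT
    (EFin \o (fun x => \sum_(i <- t | P i) f i x)).
  rewrite (_ : _ \o _ = fun x => (\sum_(i <- t | P i) (f i x)%:E)%E).
    by apply: integrable_sum => // i _; exact: intf.
  by apply/funext => x; rewrite /= sumEFin.
elim: s => [|i s IH].
  by under eq_Rintegral do rewrite big_nil; rewrite Rintegral_cst// mul0r big_nil.
rewrite big_cons -IH; case: ifPn => Pi.
  rewrite -(RintegralD measurableT (intf i) (intS s)).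
  by apply: eq_Rintegral => x _; rewrite big_cons Pi.
by apply: eq_Rintegral => x _; rewrite big_cons (negbTE Pi).
Qed.

Lemma eq0_arbitrarily_small (R : realFieldType) (x K : R) :
  (forall e, 0 < e -> `|x| <= e * K) -> x = 0.
Proof.
move=> H; apply/eqP; rewrite -normr_eq0; apply: contraT => x0.
have {}x0 : 0 < `|x| by rewrite lt_def x0 normr_ge0.
have K0 : 0 < `|K| + 1 by rewrite ltr_wpDl ?normr_ge0.
have e0 : 0 < `|x| / (2 * (`|K| + 1)) by rewrite divr_gt0// mulr_gt0.
have := H _ e0; rewrite mulrAC ler_pdivlMr ?mulr_gt0//.
have := ler_norm K; nra.
Qed.

Section truncation.
Context d (T : measurableType d) (R : realType).
Implicit Type f : T -> R.

Definition truncation f (n : nat) : T -> R := f \* \1_[set x | `|f x| <= n%:R].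

Lemma truncationE f n x : truncation f n x = if `|f x| <= n%:R then f x else 0.
Proof.
rewrite /truncation/= indicE.
case: ifPn => h; first by rewrite mem_set// mulr1.
by rewrite memNset ?mulr0//=; exact/negP.
Qed.

Lemma measurable_truncation f n : measurable_fun setT f ->
  measurable_fun setT (truncation f n).
Proof.
move=> mf; apply: measurable_funM => //; apply: measurable_indic.
have mnf : measurable_fun setT (fun x => `|f x|) by exact: measurableT_comp.
rewrite -[X in measurable X]setTI.
rewrite (_ : [set x | _] = (fun x => `|f x|) @^-1` [set` `]-oo, n%:R] ]).
  by apply: mnf => //; exact: measurable_itv.
by apply/seteqP; split=> x /=; rewrite in_itv.
Qed.

Lemma truncation_bounded f n x : `|truncation f n x| <= n%:R.
Proof. by rewrite truncationE; case: ifP; rewrite ?normr0. Qed.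

Lemma truncation_near f x : \forall n \near \oo, truncation f n x = f x.
Proof.
near=> n; rewrite truncationE ifT//.
by near: n; exact: nbhs_infty_ger.
Unshelve. all: end_near. Qed.

Lemma truncation_approx (m : {measure set T -> \bar R}) f (e : R) :
  f \in Lfun m 2%:E -> 0 < e ->
  exists n, ip m (f - truncation f n) (f - truncation f n) <= e.
Proof.
move=> f2 e0; have mf := L2_measurable f2.
pose h n x := (f - truncation f n) x ^+ 2.
have mh n : measurable_fun setT (h n).
  by apply: measurable_funX; apply: measurable_funB => //; exact: measurable_truncation.
have [] := @dominated_convergence _ _ _ m setT measurableT (fun n => EFin \o h n)
  (cst 0%E) (EFin \o (fun x => f x ^+ 2)).
- by move=> n; exact/measurable_EFinP.
- exact: measurable_cst.
- apply/nearW => x _; apply: cvg_near_cst.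
  apply: filterS (truncation_near f x) => n fn.
  by rewrite /= /h !fctE fn subrr expr0n.
- exact: Lfun2_integrable_sqr.
- apply/nearW => x n _; rewrite /= lee_fin /h !fctE truncationE.
  by case: ifP => _; rewrite ger0_norm ?sqr_ge0// ?subr0// subrr expr0n sqr_ge0.
move=> _ _; rewrite integral0 => /fine_cvgP[_] /cvgrPdist_le/(_ _ e0)[n _ /(_ n (leqnn n))].
rewrite /= sub0r normrN => /(le_trans (ler_norm _)) H.
by exists n; move: H; apply: le_trans; rewrite le_eqVlt; apply/orP; left; apply/eqP.
Unshelve. all: end_near. Qed.

End truncation.

Section riesz.
Context d (T : measurableType d) (R : realType).
Variable m : {finite_measure set T -> \bar R}.
Local Notation L2 := (Lfun m 2%:E).
Variables (L : (T -> R) -> R) (C : R).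
Hypothesis L_lin : forall a f g, f \in L2 -> g \in L2 ->
  L (a *: f + g) = a * L f + L g.
Hypothesis C0 : 0 <= C.
Hypothesis L_bnd : forall f, f \in L2 -> L f ^+ 2 <= C * ip m f f.

Let L0 : L 0 = 0.
Proof.
by have := L_lin 1 (L20 m) (L20 m); rewrite scaler0 addr0 mul1r; lra.
Qed.

Let LD f g : f \in L2 -> g \in L2 -> L (f + g) = L f + L g.
Proof. by move=> f2 g2; rewrite -[f in LHS]scale1r L_lin// mul1r. Qed.

Let LZ a f : f \in L2 -> L (a *: f) = a * L f.
Proof. by move=> f2; rewrite -[_ *: _]addr0 L_lin ?L20// L0 addr0. Qed.

Let LB f g : f \in L2 -> g \in L2 -> L (f - g) = L f - L g.
Proof. by move=> f2 g2; rewrite addrC -scaleN1r L_lin// mulN1r addrC. Qed.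

Let Lsum n (c : 'I_n -> R) (e : 'I_n -> T -> R) : (forall i, e i \in L2) ->
  L (\sum_(i < n) c i *: e i) = \sum_(i < n) c i * L (e i).
Proof.
move=> e2; have : \sum_(i < n) c i *: e i \in L2 by exact: L2_lincomb.
suff : (\sum_(i < n) c i *: e i \in L2) /\
  L (\sum_(i < n) c i *: e i) = \sum_(i < n) c i * L (e i) by case.
elim/big_ind2 : _ => [|f x g y [f2 <-] [g2 <-]|i _].
- by split; [exact: L20|].
- by split; [exact: L2D|exact: LD].
- by split; [exact: L2Z|exact: LZ].
Qed.

Let nu (B : set T) : \bar R := (L \1_B)%:E.

Let nu0 : nu set0 = 0%E.
Proof. by rewrite /nu indic0 L0. Qed.

Let nu_fin B : measurable B -> nu B \is a fin_num.
Proof. by []. Qed.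

Let nu_sigma_additive : semi_sigma_additive nu.
Proof.
move=> F mF tF mU; pose D n := \bigcup_(k in [set k | (n <= k)%N]) F k.
have mD n : measurable (D n) by apply: bigcup_measurable => k _.
have DS n : \1_(D n) = \1_(F n) + \1_(D n.+1) :> (T -> R).
  have -> : D n = F n `|` D n.+1.
    apply/seteqP; split=> x.
      move=> [k /= nk xk]; have [e|ne] := eqVneq n k; first by left; rewrite e.
      by right; exists k => //=; rewrite ltn_neqAle ne.
    by move=> [xF|[k /= nk xk]]; [exists n => //=|exists k => //=; exact: ltnW].
  apply/funext => x; rewrite /= fctE !indicE in_setU.
  have [xF|xF] := boolP (x \in F n); last by rewrite add0r.
  have [[k /= nk xk]|xD] := pselect (D n.+1 x).
    have e : n = k.
      by apply: (tF n k I I); exists x; split=> //; exact: set_mem.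
    by move: nk; rewrite e ltnn.
  by rewrite memNset// addr0.
have LDn n : \sum_(0 <= i < n) L \1_(F i) = L \1_(\bigcup_k F k) - L \1_(D n).
  elim: n => [|n IH].
    rewrite big_nil (_ : D 0%N = \bigcup_k F k) ?subrr//.
    by rewrite /D; congr bigcup; apply/seteqP; split.
  by rewrite big_nat_recr//= IH DS LD ?L2_indic//; lra.
have mDf : fine (m (D n)) @[n --> \oo] --> (0 : R).
  apply: cvg_measure_empty => //.
  - by move=> i j ij; apply/subsetPset => x [k /= jk xk]; exists k => //=; exact: leq_trans jk.
  - apply/seteqP; split => // x Dx; have [k _ xk] := Dx 0%N I.
    have [j /= kj xj] := Dx k.+1 I.
    have := tF k j I I; have kj' : k <> j by move=> e; move: kj; rewrite e ltnn.
    by apply: contraPP => _; move=> h; apply/kj'/h; exists x.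
have LD0 : L \1_(D n) @[n --> \oo] --> (0 : R).
  apply/norm_cvg0P.
  have h : Num.sqrt (C * fine (m (D n))) @[n --> \oo] --> (0 : R).
    rewrite -[0](sqrtr0 R) -[in Num.sqrt 0](mulr0 C).
    by apply: continuous_cvg; [exact: sqrt_continuous|exact: cvgMr].
  apply: squeeze_cvgr (@cvg_cst _ _ _ _ _) h.
  apply: nearW => n; rewrite normr_ge0/=; apply: le_sqr_sqrt.
  by rewrite (le_trans (L_bnd _)) ?L2_indic// ip_indic_indic// setIid.
rewrite /nu; under eq_fun do rewrite sumEFin LDn.
apply: cvg_EFin; first by apply: nearW.
rewrite -[X in _ --> X]subr0 /=.
by apply: cvgB => //; exact: cvg_cst.
Qed.

HB.instance Definition _ := isCharge.Build _ T R nu nu0 nu_fin nu_sigma_additive.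

Let nu_dom : nu `<< m.
Proof.
apply/null_content_dominatesP => B mB mB0.
rewrite /nu; have := L_bnd (L2_indic m mB).
rewrite ip_indic_indic// setIid mB0/= mulr0 => LB0.
by apply/eqP; rewrite eqe -sqrf_eq0 eq_le LB0 sqr_ge0.
Qed.

Let g x : R := fine (Radon_Nikodym nu m x).

Let g_int : m.-integrable setT (EFin \o g).
Proof.
apply: eq_integrable (Radon_Nikodym_integrable nu_dom) => // x _.
by rewrite /g/= fineK// Radon_Nikodym_fin_num.
Qed.

Let g_indic B : measurable B -> L \1_B = \int[m]_(x in B) g x.
Proof.
move=> mB; rewrite -[LHS]/(fine (nu B)) (Radon_Nikodym_integral nu_dom mB).
by congr fine; apply: eq_integral => x _; rewrite /g fineK// Radon_Nikodym_fin_num.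
Qed.

Let g_mul_int (f : T -> R) M : measurable_fun setT f -> (forall x, `|f x| <= M) ->
  m.-integrable setT (EFin \o (g \* f)).
Proof.
move=> mf fM; have gM : m.-integrable setT (EFin \o (fun x => M * g x)).
  exact: integrable_scale.
apply: le_integrable gM => //.
  apply/measurable_EFinP/measurable_funM => //.
  by apply/measurable_EFinP; exact: measurable_int g_int.
move=> x _; rewrite lee_fin !normrM mulrC ler_wpM2r//.
by rewrite (le_trans (fM x))// ler_norm.
Qed.

Let L_bounded (f : T -> R) M : measurable_fun setT f -> (forall x, `|f x| <= M) ->
  L f = \int[m]_x (g x * f x).
Proof.
move=> mf fM; apply/eqP; rewrite -subr_eq0; apply/eqP.
pose K := Num.sqrt (C * fine (m setT)) + \int[m]_x `|g x|.
apply: (@eq0_arbitrarily_small _ _ K) => e e0.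
have [n [c [B [mB fB]]]] := uniform_step_approx mf fM e0.
pose s := \sum_(i < n) c i *: (\1_(B i) : T -> R).
have s2 : s \in L2 by apply: L2_lincomb => i; exact: L2_indic.
have f2 : f \in L2 by exact: L2_bounded fM.
pose r := f - s; have r2 : r \in L2 by exact: L2B.
have mr := L2_measurable r2.
have LsE : L s = \int[m]_x (g x * s x).
  rewrite /s Lsum => [|i]; last exact: L2_indic.
  have -> : \int[m]_x (g x * (\sum_(i < n) c i *: \1_(B i)) x) =
      \int[m]_x (\sum_(i < n) c i * (g x * \1_(B i) x)).
    apply: eq_Rintegral => x _; rewrite lincombE mulr_sumr.
    by apply: eq_bigr => i _; rewrite mulrCA.
  have gB i : m.-integrable setT (EFin \o (g \* \1_(B i))).
    apply: (@g_mul_int _ 1) => [|x]; first exact: measurable_indic.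
    by rewrite indicE; case: (_ \in _); rewrite ?normr1 ?normr0.
  rewrite (@Rintegral_sum _ _ _ m _ _ _ (fun i x => c i * (g x * \1_(B i) x))); last first.
    by move=> i; exact: integrable_scale (gB i).
  by apply: eq_bigr => i _; rewrite (RintegralZl _ measurableT (gB i)) g_indic// -ip_indic.
have fE : \int[m]_x (g x * f x) = \int[m]_x (g x * r x) + \int[m]_x (g x * s x).
  rewrite -RintegralD//.
  - by apply: eq_Rintegral => x _; rewrite -mulrDr /r; congr (_ * _); rewrite !fctE subrK.
  - exact: (@g_mul_int _ e).
  - apply: (@g_mul_int _ (M + e)); first exact: L2_measurable s2.
    move=> x; rewrite (_ : s x = f x - r x); last by rewrite /r !fctE; ring.
    by rewrite (le_trans (ler_normB _ _))// lerD.
rewrite fE -LsE opprD addrA addrAC -LB// -/r.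
rewrite (le_trans (ler_normB _ _))// mulrDr lerD//.
- have -> : e * Num.sqrt (C * fine (m setT)) = Num.sqrt (C * (e ^+ 2 * fine (m setT))).
    by rewrite [in RHS]mulrCA [in RHS]sqrtrM ?sqr_ge0// sqrtr_sqr gtr0_norm.
  apply: le_sqr_sqrt; rewrite (le_trans (L_bnd r2))// ler_wpM2l//.
  rewrite -(Rintegral_cst m)//; apply: le_Rintegral => //.
  - exact: L2_mul_integrable.
  - exact: finite_measure_integrable_cst.
  - by move=> x _; rewrite -expr2 -real_normK ?num_real// lerXn2r ?nnegrE// ltW.
- apply: le_trans (le_normr_Rintegral _ _) _ => //; first exact: (@g_mul_int _ e).
  rewrite -RintegralZl//; last exact: integrable_norm.
  apply: le_Rintegral => //.
  - by apply: integrable_norm; exact: (@g_mul_int _ e).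
  - by apply: integrable_scale; exact: integrable_norm.
  - by move=> x _; rewrite normrM mulrC ler_wpM2r.
Qed.

Let mg : measurable_fun setT g.
Proof. by apply/measurable_EFinP; exact: measurable_int g_int. Qed.

Let g_truncation n : ip m (truncation g n) (truncation g n) <= C.
Proof.
set gn := truncation g n; have mgn : measurable_fun setT gn by exact: measurable_truncation.
have gn2 : gn \in L2 by exact: L2_bounded (truncation_bounded g n).
have LE : L gn = ip m gn gn.
  rewrite (L_bounded mgn (truncation_bounded g n)); apply: eq_Rintegral => x _.
  by rewrite /gn truncationE; case: ifP; rewrite ?mulr0.
have := L_bnd gn2; rewrite LE expr2.
have := ip_ge0 m gn; rewrite le_eqVlt => /predU1P[<-//|gn0].
by rewrite ler_pM2r.
Qed.

Let g2 : g \in L2.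
Proof.
have mgn n : measurable_fun setT (truncation g n) by exact: measurable_truncation.
apply: L2I => //; apply/integrableP; split.
  by apply/measurable_EFinP; exact: measurable_funX.
apply: (@le_lt_trans _ _ C%:E); last exact: ltry.
have -> : (\int[m]_x `|(EFin \o (fun x => g x ^+ 2)%R) x| =
    \int[m]_x limn (fun n => (truncation g n x ^+ 2)%R%:E))%E.
  apply: eq_integral => x _; rewrite gee0_abs ?lee_fin ?sqr_ge0//.
  apply/esym/cvg_lim => //; apply: cvg_near_cst.
  by apply: filterS (truncation_near g x) => n /= ->.
have nd x : {homo (fun n => (truncation g n x ^+ 2)%:E) : n k / (n <= k)%N >-> (n <= k)%E}.
  move=> n k nk; rewrite lee_fin !truncationE; case: ifPn => [gn|_].
    by rewrite ifT// (le_trans gn)// ler_nat.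
  by rewrite expr0n sqr_ge0.
rewrite monotone_convergence//.
- apply: lime_le.
    apply: ereal_nondecreasing_is_cvgn => n k nk; apply: ge0_le_integral => //.
    + by move=> x _; rewrite lee_fin sqr_ge0.
    + by apply/measurable_EFinP; exact: measurable_funX.
    + by apply/measurable_EFinP; exact: measurable_funX.
    + by move=> x _; exact: nd.
  apply: nearW => n; have := g_truncation n; rewrite -lee_fin; apply: le_trans.
  have gn2 : truncation g n \in L2 by exact: L2_bounded (truncation_bounded g n).
  rewrite /ip /Rintegral fineK//.
  by apply: integrable_fin_num => //; exact: L2_mul_integrable.
- by move=> n; apply/measurable_EFinP; exact: measurable_funX.
- by move=> n x _; rewrite lee_fin sqr_ge0.
Qed.

(** B |-> L 1_B is a finite signed measure, absolutely continuous with respect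
    to m because |L 1_B|^2 <= C m(B).  Its density g represents L on bounded
    functions, by uniform approximation.  Testing L on the truncations g_n of g
    gives ||g_n||^4 <= C ||g_n||^2, so g is in L2 by monotone convergence, and
    bounded functions are dense in L2. *)
Lemma L2_riesz : exists2 h : T -> R, h \in L2 & forall f, f \in L2 -> L f = ip m h f.
Proof.
exists g => // f f2.
apply/eqP; rewrite -subr_eq0 -sqrf_eq0; apply/eqP.
apply: (@eq0_arbitrarily_small _ _ (2 * (C + ip m g g))) => e e0.
have [n fn] := truncation_approx f2 e0.
set fb := truncation f n; pose r := f - fb.
have fb2 : fb \in L2.
  apply: L2_bounded (truncation_bounded f n).
  exact/measurable_truncation/(L2_measurable f2).
have r2 : r \in L2 by exact: L2B.
have -> : L f - ip m g f = L r - ip m g r.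
  rewrite LB// ipBr// (L_bounded (L2_measurable fb2) (truncation_bounded f n)).
  by rewrite -[\int[m]_x _]/(ip m g fb); ring.
rewrite ger0_norm ?sqr_ge0//.
have := L_bnd r2; have := cauchy_schwarz g2 r2; have := ip_ge0 m g => g0 h1 h2.
have : (L r - ip m g r) ^+ 2 <= 2 * (L r ^+ 2 + ip m g r ^+ 2).
  by have := sqr_ge0 (L r + ip m g r); nra.
move/le_trans; apply; rewrite mulrCA ler_wpM2l//.
rewrite mulrC (le_trans (lerD h2 h1))// -mulrDl ler_wpM2l// addr_ge0//.
Qed.

End riesz.

(** * Weak compactness and orthonormal bases *)

Lemma ultra_bounded_cvg (R : realType) (J : Type) (U : set_system J)
    (u : J -> R) (M : R) :
  UltraFilter U -> (forall j, `|u j| <= M) -> exists l : R, u @ U --> l.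
Proof.
move=> UU uM; have UP : ProperFilter U by exact: ultra_proper.
have : compact `[- M, M] by exact: segment_compact.
move=> /(_ (u @ U) _) [|l [_ ul]].
  by apply: (@filterS _ U _ _ _ _ (@filterT _ U _)) => j _ /=; rewrite in_itv/= -ler_norml.
(* The cluster point l is a limit: U contains the preimage of any set or that
   of its complement. *)
exists l => W lW; have [//|UW] := in_ultra_setVsetC (u @^-1` W) UU.
by have [x []] := ul (~` W) W UW lW.
Qed.

Section weak_compactness.
Context d (T : measurableType d) (R : realType).
Variable m : {finite_measure set T -> \bar R}.
Local Notation L2 := (Lfun m 2%:E).

(** Bounded real nets converge along an ultrafilter, so f |-> lim <h_j, f> is a
    bounded linear functional; its Riesz representative is the weak limit. *)
Lemma weak_ultralimit (J : Type) (U : set_system J) (h : J -> T -> R) (C : R) :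
  UltraFilter U -> (forall j, h j \in L2) -> (forall j, ip m (h j) (h j) <= C) ->
  exists2 g : T -> R, g \in L2 &
    forall f, f \in L2 -> ip m (h j) f @[j --> U] --> ip m g f.
Proof.
move=> UU h2 hC; have UP : ProperFilter U by exact: ultra_proper.
have C0 : 0 <= C.
  have [j _] := filter_ex (@filterT _ U _); exact: le_trans (ip_ge0 m (h j)) (hC j).
pose L f := lim (ip m (h j) f @[j --> U]).
have hf f j : f \in L2 -> ip m (h j) f ^+ 2 <= C * ip m f f.
  move=> f2; apply: le_trans (cauchy_schwarz (h2 j) f2) _.
  by rewrite ler_wpM2r ?ip_ge0.
have Lcvg f : f \in L2 -> ip m (h j) f @[j --> U] --> L f.
  move=> f2; have [j|l lE] := @ultra_bounded_cvg R J U (fun j => ip m (h j) f)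
    (Num.sqrt (C * ip m f f)) UU.
    exact/le_sqr_sqrt/hf.
  by apply: (cvgP l).
have L_lin a f g : f \in L2 -> g \in L2 -> L (a *: f + g) = a * L f + L g.
  move=> f2 g2; apply: cvg_lim => //.
  have : a * ip m (h j) f + ip m (h j) g @[j --> U] --> a * L f + L g.
    by apply: cvgD; [apply: cvgMr; exact: Lcvg|exact: Lcvg].
  by under eq_fun do rewrite -ipZr// -ipDr ?L2Z//.
have L_bnd f : f \in L2 -> L f ^+ 2 <= C * ip m f f.
  move=> f2; have : ip m (h j) f ^+ 2 @[j --> U] --> L f ^+ 2.
    by rewrite expr2; under eq_fun do rewrite expr2; apply: cvgM; exact: Lcvg.
  move=> Lf; rewrite -(cvg_lim (@Rhausdorff R) Lf); apply: limr_le; first exact: cvgP Lf.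
  by apply: nearW => j; exact: hf.
have [g g2 Lg] := L2_riesz L_lin C0 L_bnd.
by exists g => // f f2; rewrite -Lg//; exact: Lcvg.
Qed.

End weak_compactness.

Section orthonormal.
Context d (T : measurableType d) (R : realType).
Variable m : {finite_measure set T -> \bar R}.
Local Notation L2 := (Lfun m 2%:E).
Variables (I : choiceType) (e : I -> T -> R).
Hypothesis e2 : forall i, e i \in L2.
Hypothesis e_orth : forall i j, ip m (e i) (e j) = (i == j)%:R.

Definition projection (F : {fset I}) (f : T -> R) : T -> R :=
  \sum_(i <- F) ip m f (e i) *: e i.

Lemma L2_projection F f : projection F f \in L2.
Proof. exact: L2_lincomb. Qed.

Lemma ip_lincomb_basis (F : {fset I}) (c : I -> R) j :
  ip m (\sum_(i <- F) c i *: e i) (e j) = if j \in F then c j else 0.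
Proof.
rewrite ip_suml//; case: ifPn => jF.
  rewrite (bigD1_seq j) ?fset_uniq//= e_orth eqxx mulr1 big1 ?addr0// => i ij.
  by rewrite e_orth (negbTE ij) mulr0.
rewrite big_seq big1// => i iF; rewrite e_orth; case: eqVneq => [ij|]; last by rewrite mulr0.
by move: jF; rewrite -ij iF.
Qed.

Lemma ip_lincomb (F : {fset I}) (c : I -> R) :
  ip m (\sum_(i <- F) c i *: e i) (\sum_(i <- F) c i *: e i) = \sum_(i <- F) c i ^+ 2.
Proof.
rewrite ip_sumr// ?L2_lincomb//; rewrite big_seq [RHS]big_seq; apply: eq_bigr => i iF.
by rewrite ip_lincomb_basis iF expr2.
Qed.

Lemma ip_projection F f : f \in L2 ->
  ip m (projection F f) f = \sum_(i <- F) ip m f (e i) ^+ 2.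
Proof.
move=> f2; rewrite ip_suml//; apply: eq_bigr => i _.
by rewrite expr2 (ipC m f).
Qed.

Lemma ip_projection_residual F f : f \in L2 ->
  ip m (f - projection F f) (f - projection F f) =
  ip m f f - \sum_(i <- F) ip m f (e i) ^+ 2.
Proof.
move=> f2; have p2 := L2_projection F f.
rewrite ipBl ?L2B// !ipBr// (ipC m f (projection F f)) ip_projection//.
by rewrite {1}/projection ip_lincomb; ring.
Qed.

Lemma bessel (F : {fset I}) f : f \in L2 -> \sum_(i <- F) ip m f (e i) ^+ 2 <= ip m f f.
Proof.
move=> f2; have := ip_ge0 m (f - projection F f).
by rewrite ip_projection_residual// subr_ge0.
Qed.

Hypothesis e_complete : forall f, f \in L2 -> (forall i, ip m f (e i) = 0) ->
  {ae m, forall x, f x = 0}.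

(** Completeness of the basis says only that the orthogonal complement is
    trivial.  Along an ultrafilter finer than the tails of finite sets of indices,
    the projections of f have a weak limit g with the same coefficients as f, so
    g = f almost everywhere; then ||proj_F f||^2 = <proj_F f, f> tends to ||f||^2. *)
Lemma projection_approx f (del : R) : f \in L2 -> 0 < del ->
  exists F0 : {fset I}, forall F, (F0 `<=` F)%fset ->
    ip m (f - projection F f) (f - projection F f) <= del.
Proof.
move=> f2 d0.
pose tails : set_system {fset I} :=
  filter_from setT (fun A => [set B | (A `<=` B)%fset]).
have tailsP : ProperFilter tails.
  apply: filter_from_proper; last by move=> A _; exists A; rewrite /= fsubset_refl.
  apply: filter_fromT_filter; first by exists fset0.
  by move=> A B /=; exists (A `|` B)%fset => P /=; rewrite fsubUset => /andP[].
have [U [UU tU]] := ultraFilterLemma tailsP; have UP : ProperFilter U by exact: ultra_proper.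
have [|g g2 gE] := weak_ultralimit UU (fun F => L2_projection F f)
    (C := ip m f f).
  by move=> F; rewrite {1}/projection ip_lincomb bessel.
have gf : {ae m, forall x, (f - g) x = 0}.
  apply: e_complete => [|i]; first exact: L2B.
  rewrite ipBl//; apply/eqP; rewrite subr_eq0; apply/eqP.
  have := gE _ (e2 i); have : ip m (projection F f) (e i) @[F --> U] --> ip m f (e i).
    apply: cvg_near_cst; apply: tU; exists [fset i]%fset => //= F /=.
    by rewrite fsub1set => iF; rewrite /projection ip_lincomb_basis iF.
  exact: cvg_unique.
have ff : ip m g f = ip m f f.
  apply/esym; apply: ip_ae; [exact: L2_measurable f2|exact: L2_measurable g2|
    exact: L2_measurable f2|].
  by apply: filterS gf => x /eqP; rewrite subr_eq0 => /eqP.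
have := gE _ f2; rewrite ff => /cvgrPdist_le /(_ _ d0) /filter_ex [F0].
rewrite ip_projection// => H.
exists F0 => F /fsubsetP F0F; rewrite ip_projection_residual//.
apply: le_trans (le_trans (ler_norm _) H); rewrite lerB//.
rewrite [leRHS](bigID (mem F0))/=.
rewrite [X in _ <= X + _](_ : _ = \sum_(i <- F0) ip m f (e i) ^+ 2).
  by rewrite lerDl sumr_ge0// => i _; exact: sqr_ge0.
rewrite -big_filter; apply: perm_big; apply: uniq_perm.
- by rewrite filter_uniq.
- exact: fset_uniq.
- by move=> i; rewrite mem_filter/=; case: (boolP (i \in F0)) => // /F0F ->.
Qed.

End orthonormal.

(** * Traces of compressions of positive semidefinite matrices *)

Section trace_compression.
Variables (R : rcfType) (J : finType).
Implicit Types (q : J -> J -> R) (v w : J -> R).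

Definition qform q v w := \sum_i \sum_j v i * w j * q i j.

Lemma qform_shift q v w t : (forall i j, q i j = q j i) ->
  qform q (fun i => v i - t * w i) (fun i => v i - t * w i) =
  qform q v v - 2 * t * qform q v w + t ^+ 2 * qform q w w.
Proof.
move=> qC; have qvw : qform q w v = qform q v w.
  rewrite /qform exchange_big; apply: eq_bigr => i _; apply: eq_bigr => j _.
  by rewrite qC; ring.
rewrite (_ : 2 * t * qform q v w = t * qform q v w + t * qform q w v); last by rewrite qvw; ring.
rewrite opprD addrA /qform !mulr_sumr -!sumrB -big_split/=.
apply: eq_bigr => i _; rewrite !mulr_sumr -!sumrB -big_split/=.
by apply: eq_bigr => j _; ring.
Qed.

Lemma qform_delta q v k :
  qform q v (fun j => (j == k)%:R) = \sum_i v i * q i k.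
Proof.
apply: eq_bigr => i _; rewrite (bigD1 k)//= eqxx mulr1 big1 ?addr0// => j jk.
by rewrite (negbTE jk) mulr0 mul0r.
Qed.

Lemma qform_rank_one v a : qform (fun i j => a i * a j) v v = (\sum_i v i * a i) ^+ 2.
Proof.
rewrite expr2 mulr_suml; apply: eq_bigr => i _; rewrite mulr_sumr.
by apply: eq_bigr => j _; ring.
Qed.

Section psd.
Variable q : J -> J -> R.
Hypothesis qC : forall i j, q i j = q j i.
Hypothesis q0 : forall v, 0 <= qform q v v.

Lemma qform_deltas k l :
  qform q (fun j => (j == k)%:R) (fun j => (j == l)%:R) = q k l.
Proof.
rewrite qform_delta (bigD1 k)//= eqxx mul1r big1 ?addr0//.
by move=> i /negbTE->; rewrite mul0r.
Qed.

Lemma psd_diag_ge0 k : 0 <= q k k.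
Proof. by rewrite -qform_deltas. Qed.

Lemma psd_cauchy_schwarz v k :
  (\sum_i v i * q i k) ^+ 2 <= qform q v v * q k k.
Proof.
rewrite -qform_delta -(qform_deltas k k).
by apply: discriminant_le0 => // t; rewrite -qform_shift.
Qed.

Lemma psd_entry_le i j : q i j ^+ 2 <= q i i * q j j.
Proof.
have := psd_cauchy_schwarz (fun k => (k == i)%:R) j.
by rewrite qform_deltas -qform_delta qform_deltas.
Qed.

Lemma psd_row0 i j : q j j = 0 -> q i j = 0.
Proof.
move=> qj; have := psd_entry_le i j; rewrite qj mulr0 => qij.
by apply/eqP; rewrite -sqrf_eq0 eq_le qij sqr_ge0.
Qed.

End psd.

(** This is tr(C q C^T) <= tr q for a contraction C, the hypothesis on c being
    Bessel's inequality.  One step of the Cholesky decomposition splits q into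
    a a^T, to which the contraction property applies directly, and a positive
    semidefinite remainder with one nonzero diagonal entry fewer. *)
Lemma trace_compression (K : finType) (c : K -> J -> R) q :
  (forall w, \sum_k (\sum_i c k i * w i) ^+ 2 <= \sum_i w i ^+ 2) ->
  (forall i j, q i j = q j i) -> (forall v, 0 <= qform q v v) ->
  \sum_k qform q (c k) (c k) <= \sum_i q i i.
Proof.
move=> cB; pose supp q := [pred i | q i i != 0 :> R].
move: {2}#|supp q| (leqnn #|supp q|) => n.
elim: n q => [|n IH] q qn qC q0.
  rewrite big1 ?sumr_ge0// => [i _|k _]; first exact: psd_diag_ge0.
  rewrite /qform big1// => i _; rewrite big1// => j _.
  rewrite psd_row0 ?mulr0//; apply/eqP; move: qn; rewrite leqn0 => /eqP/card0_eq/(_ j).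
  by rewrite inE => /negbFE.
have [k qk|qz] := pickP (fun k => q k k != 0); last first.
  by apply: IH => //; rewrite eq_card0// => i; rewrite inE qz.
have qk0 : 0 < q k k by rewrite lt_def qk psd_diag_ge0.
pose a i := q i k / Num.sqrt (q k k).
pose q' i j := q i j - a i * a j.
have sq : Num.sqrt (q k k) != 0 by rewrite gt_eqF// sqrtr_gt0.
have sqE : Num.sqrt (q k k) ^+ 2 = q k k by rewrite sqr_sqrtr// ltW.
have q'E v : qform q' v v = qform q v v - (\sum_i v i * a i) ^+ 2.
  rewrite -qform_rank_one /qform -sumrB; apply: eq_bigr => i _.
  by rewrite -sumrB; apply: eq_bigr => j _; rewrite /q'; ring.
have := IH q'.
have -> : \sum_i q' i i = \sum_i q i i - \sum_i a i ^+ 2 by rewrite -sumrB.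
have -> : \sum_k0 qform q' (c k0) (c k0) =
    \sum_k0 qform q (c k0) (c k0) - \sum_k0 (\sum_i c k0 i * a i) ^+ 2.
  by rewrite -sumrB; apply: eq_bigr => l _; exact: q'E.
move=> {}IH; suff : \sum_k0 qform q (c k0) (c k0) - \sum_k0 (\sum_i c k0 i * a i) ^+ 2 <=
    \sum_i q i i - \sum_i a i ^+ 2 by have := cB a; lra.
apply: IH.
- rewrite -ltnS; apply: leq_trans qn; apply: proper_card; apply/properP; split.
    apply/fintype.subsetP => i; rewrite !inE; apply: contraNN => /eqP qi.
    by rewrite /q' /a (qC i k) (psd_row0 qC q0 k qi) !mul0r subr0 qi.
  exists k; rewrite !inE// negbK /q' /a; apply/eqP.
  by rewrite mulf_div -[Num.sqrt _ * _]expr2 sqE mulfK ?subrr.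
- by move=> i j; rewrite /q' qC mulrC.
- move=> v; rewrite q'E subr_ge0.
  have -> : \sum_i v i * a i = (\sum_i v i * q i k) / Num.sqrt (q k k).
    by rewrite mulr_suml; apply: eq_bigr => i _; rewrite mulrA.
  by rewrite expr_div_n sqE ler_pdivrMr// psd_cauchy_schwarz.
Qed.

End trace_compression.

(** * The square of a finite measure *)

Section product_finite.
Context d (V : measurableType d) (R : realType).
Variable mu : {finite_measure set V -> \bar R}.

(** The name carries the finite measure structure of the product. *)
Definition square_measure : set (V * V) -> \bar R := (mu \x mu)%E.

HB.instance Definition _ := Measure.copy square_measure (mu \x mu)%E.

Lemma square_measureX (A B : set V) : measurable A -> measurable B ->
  square_measure (A `*` B) = (mu A * mu B)%E.
Proof. exact: product_measure1E. Qed.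

Let square_measure_fin : fin_num_fun square_measure.
Proof.
apply: lty_fin_num_fun; rewrite /= -setXTT square_measureX//.
by rewrite ltey_eq fin_numM// fin_num_measure.
Qed.

HB.instance Definition _ :=
  Measure_isFinite.Build _ _ _ square_measure square_measure_fin.

End product_finite.

Section product.
Context d (V : measurableType d) (R : realType).
Variable mu : {finite_measure set V -> \bar R}.
Local Notation mu2 := (square_measure mu).
Implicit Types (f g : V -> R) (F G : V * V -> R) (X : set (V * V)).

Lemma measurable_tensor f g : measurable_fun setT f -> measurable_fun setT g ->
  measurable_fun setT (tensor f g).
Proof.
move=> mf mg; apply: measurable_funM.
  by apply: measurableT_comp mf _; exact: measurable_fst.
by apply: measurableT_comp mg _; exact: measurable_snd.
Qed.

Lemma tensor_integrable f g : mu.-integrable setT (EFin \o f) ->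
  mu.-integrable setT (EFin \o g) -> mu2.-integrable setT (EFin \o tensor f g).
Proof.
move=> intf intg.
have mf : measurable_fun setT f by apply/measurable_EFinP; exact: measurable_int intf.
have mg : measurable_fun setT g by apply/measurable_EFinP; exact: measurable_int intg.
apply/integrable12ltyP; first by apply/measurable_EFinP; exact: measurable_tensor.
move: (intf) (intg) => /integrableP[_ f1] /integrableP[_ g1].
under eq_integral => x _.
  under eq_integral do rewrite /tensor/= normrM EFinM.
  rewrite ge0_integralZl//; last first.
    by apply/measurable_EFinP; apply: measurableT_comp.
  over.
rewrite ge0_integralZr//; last 2 first.
  - by apply/measurable_EFinP; apply: measurableT_comp.
  - exact: integral_ge0.
by rewrite lte_mul_pinfty ?integral_ge0// ge0_fin_numE ?integral_ge0.
Qed.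

Lemma Rintegral_tensor f g : mu.-integrable setT (EFin \o f) ->
  mu.-integrable setT (EFin \o g) ->
  \int[mu2]_p tensor f g p = (\int[mu]_x f x) * (\int[mu]_x g x).
Proof.
move=> intf intg; rewrite -RintegralZr//; congr fine.
rewrite -(integral12_prod_meas1 (tensor_integrable intf intg)).
apply: eq_integral => x _; rewrite /fubini_F/=.
under eq_integral do rewrite /tensor/= EFinM.
by rewrite integralZl// EFinM fineK// integrable_fin_num.
Qed.

Lemma L2_tensor f g : f \in Lfun mu 2%:E -> g \in Lfun mu 2%:E ->
  tensor f g \in Lfun mu2 2%:E.
Proof.
move=> f2 g2; apply: L2I; first by apply: measurable_tensor; [exact: L2_measurable f2|exact: L2_measurable g2].
rewrite (_ : (fun x => _) = tensor (fun x => f x ^+ 2) (fun x => g x ^+ 2)).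
  by apply: tensor_integrable; exact: Lfun2_integrable_sqr.
by apply/funext => p; rewrite /tensor exprMn.
Qed.

Lemma ip_tensor f g f' g' : f \in Lfun mu 2%:E -> g \in Lfun mu 2%:E ->
  f' \in Lfun mu 2%:E -> g' \in Lfun mu 2%:E ->
  ip mu2 (tensor f g) (tensor f' g') = ip mu f f' * ip mu g g'.
Proof.
move=> f2 g2 f2' g2'; rewrite -Rintegral_tensor; try exact: L2_mul_integrable.
by apply: eq_Rintegral => p _; rewrite /tensor; ring.
Qed.

Definition swap (p : V * V) := (p.2, p.1).

Lemma measurable_swap : measurable_fun setT swap.
Proof. by apply: measurable_fun_pair; [exact: measurable_snd|exact: measurable_fst]. Qed.

Lemma integrable_swap F : mu2.-integrable setT (EFin \o F) ->
  mu2.-integrable setT (EFin \o (F \o swap)).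
Proof.
move=> intF; have mF := measurable_int _ intF.
apply/integrable12ltyP; last by move/(integrable21ltyP mu mu mF) : intF.
by apply: measurableT_comp mF _; exact: measurable_swap.
Qed.

Lemma Rintegral_swap F : mu2.-integrable setT (EFin \o F) ->
  \int[mu2]_p F (swap p) = \int[mu2]_p F p.
Proof.
move=> intF; congr fine; rewrite -(integral12_prod_meas1 (integrable_swap intF)).
by rewrite -(integral21_prod_meas1 intF).
Qed.

Lemma ip_swap F G : F \in Lfun mu2 2%:E -> G \in Lfun mu2 2%:E ->
  ip mu2 (F \o swap) (G \o swap) = ip mu2 F G.
Proof.
move=> F2 G2; exact: (@Rintegral_swap (fun p => F p * G p)) (L2_mul_integrable F2 G2).
Qed.

End product.

(** * The trace does not depend on the basis *)

Section kernel_form.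
Context d (V : measurableType d) (R : realType).
Variable mu : {finite_measure set V -> \bar R}.
Local Notation mu2 := (square_measure mu).
Local Notation L2 := (Lfun mu 2%:E).
Variable A : V * V -> R.
Hypothesis A2 : A \in Lfun mu2 2%:E.
Implicit Types f g : V -> R.

Definition kform f g := ip mu2 A (tensor f g).

Lemma kform_suml (I : Type) (s : seq I) (c : I -> R) (e : I -> V -> R) g :
  (forall i, e i \in L2) -> g \in L2 ->
  kform (\sum_(i <- s) c i *: e i) g = \sum_(i <- s) c i * kform (e i) g.
Proof.
move=> e2 g2; rewrite /kform -ip_sumr//; last by move=> i; exact: L2_tensor.
congr ip; apply/funext => p; rewrite /tensor !lincombE mulr_suml.
by apply: eq_bigr => i _; rewrite mulrA.
Qed.

Lemma kform_sumr (I : Type) (s : seq I) (c : I -> R) (e : I -> V -> R) f :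
  (forall i, e i \in L2) -> f \in L2 ->
  kform f (\sum_(i <- s) c i *: e i) = \sum_(i <- s) c i * kform f (e i).
Proof.
move=> e2 f2; rewrite /kform -ip_sumr//; last by move=> i; exact: L2_tensor.
congr ip; apply/funext => p; rewrite /tensor !lincombE mulr_sumr.
by apply: eq_bigr => i _; rewrite mulrCA.
Qed.

Lemma kformDl f g h : f \in L2 -> g \in L2 -> h \in L2 ->
  kform (f + g) h = kform f h + kform g h.
Proof.
move=> f2 g2 h2; rewrite /kform -ipDr ?L2_tensor//; congr ip.
by apply/funext => p; rewrite /tensor !fctE mulrDl.
Qed.

Lemma kformDr f g h : f \in L2 -> g \in L2 -> h \in L2 ->
  kform h (f + g) = kform h f + kform h g.
Proof.
move=> f2 g2 h2; rewrite /kform -ipDr ?L2_tensor//; congr ip.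
by apply/funext => p; rewrite /tensor !fctE mulrDr.
Qed.

Lemma kformZl a f g : f \in L2 -> g \in L2 -> kform (a *: f) g = a * kform f g.
Proof.
move=> f2 g2; rewrite /kform -ipZr ?L2_tensor//; congr ip.
by apply/funext => p; rewrite /tensor !fctE -mulrA.
Qed.

Lemma kformZr a f g : f \in L2 -> g \in L2 -> kform f (a *: g) = a * kform f g.
Proof.
move=> f2 g2; rewrite /kform -ipZr ?L2_tensor//; congr ip.
by apply/funext => p; rewrite /tensor !fctE; rewrite [LHS]mulrCA.
Qed.

Lemma kform_le f : f \in L2 -> kform f f <= Num.sqrt (ip mu2 A A) * ip mu f f.
Proof.
move=> f2; apply: le_trans (ler_norm _) _.
have := cauchy_schwarz A2 (L2_tensor f2 f2).
rewrite ip_tensor// -expr2 => /le_sqr_sqrt/le_trans; apply.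
by rewrite sqrtrM ?ip_ge0// sqrtr_sqr ger0_norm ?ip_ge0.
Qed.

Hypothesis Asym : {ae mu2, forall p, A p = A (p.2, p.1)}.

Lemma kformC f g : f \in L2 -> g \in L2 -> kform f g = kform g f.
Proof.
move=> f2 g2; rewrite /kform -[RHS]ip_swap ?L2_tensor//.
have -> : tensor g f \o @swap _ V = tensor f g.
  by apply/funext => p; rewrite /tensor/= mulrC.
have mA := L2_measurable A2.
apply: ip_ae => //; last by apply: L2_measurable (L2_tensor f2 g2).
by apply: measurableT_comp mA _; exact: measurable_swap.
Qed.

Hypothesis Apsd : psd mu A.

Lemma kform_ge0 f : f \in L2 -> 0 <= kform f f.
Proof. exact: Apsd. Qed.

(** Expand kform (s f - g) (s f - g) >= 0 to bound the mixed terms. *)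
Lemma kform_young f g s : 0 < s -> f \in L2 -> g \in L2 ->
  kform (f + g) (f + g) <= (1 + s) * kform f f + (1 + s^-1) * kform g g.
Proof.
move=> s0 f2 g2; have sf : s *: f \in L2 by exact: L2Z.
have ng : (-1) *: g \in L2 by exact: L2Z.
have := kform_ge0 (L2D sf ng).
rewrite !(kformDl, kformDr, kformZl, kformZr, L2D)// => H.
have : s * (kform f g + kform g f) <= s ^+ 2 * kform f f + kform g g by lra.
rewrite -ler_pdivlMl// mulrDr [s ^+ 2]expr2 -mulrA mulKf ?gt_eqF//.
lra.
Qed.

Section trace.
Variables (I : choiceType) (e : I -> V -> R).
Hypothesis eB : orthonormal_basis mu e.
Let e2 i : e i \in L2. Proof. by case: eB. Qed.
Let eo i j : ip mu (e i) (e j) = (i == j)%:R. Proof. by case: eB => _ + _; apply. Qed.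

Lemma qform_kform (J : finType) (h : J -> V -> R) v : (forall j, h j \in L2) ->
  qform (fun i j => kform (h i) (h j)) v v =
  kform (\sum_j v j *: h j) (\sum_j v j *: h j).
Proof.
move=> h2; rewrite kform_suml ?L2_lincomb//; apply: eq_bigr => i _.
rewrite kform_sumr// mulr_sumr; apply: eq_bigr => j _; rewrite mulrA.
by [].
Qed.

Variables (K : finType) (u : K -> V -> R).
Hypothesis u2 : forall k, u k \in L2.
Hypothesis uB : forall f, f \in L2 -> \sum_k ip mu (u k) f ^+ 2 <= ip mu f f.

Lemma trace_projections (F : {fset I}) :
  \sum_k kform (projection mu e F (u k)) (projection mu e F (u k)) <=
  \sum_(i <- F) kform (e i) (e i).
Proof.
pose q (i j : F) := kform (e (val i)) (e (val j)).
pose c k (i : F) := ip mu (u k) (e (val i)).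
have projE k : projection mu e F (u k) = \sum_(i : F) c k i *: e (val i).
  by rewrite /projection big_seq_fsetE.
under eq_bigr do rewrite projE -qform_kform//.
rewrite big_seq_fsetE; apply: (@trace_compression _ _ _ c q).
- move=> w; pose g := \sum_(i : F) w i *: e (val i).
  have g2 : g \in L2 by exact: L2_lincomb.
  have -> : \sum_i w i ^+ 2 = ip mu g g.
    rewrite ip_suml//; apply: eq_bigr => i _; rewrite ip_sumr// (bigD1 i)//= big1 ?addr0.
      by rewrite eo eqxx mulr1 expr2.
    by move=> j ji; rewrite eo -val_eqE eq_sym in ji *; rewrite (negbTE ji) mulr0.
  apply: le_trans (uB g2); apply: ler_sum => k _; rewrite ip_sumr//.
  by under [X in _ <= X ^+ 2]eq_bigr do rewrite mulrC.
- by move=> i j; exact: kformC.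
- by move=> v; rewrite qform_kform//; apply: kform_ge0; exact: L2_lincomb.
Qed.

(** For the projections of the u_k on finitely many e_i this is
    trace_compression.  The remainders tend to 0 in L2, hence so do their
    diagonal coefficients, and Young's inequality controls the mixed terms. *)
Lemma trace_bessel t :
  \esum_(i in [set: I]) (kform (e i) (e i))%:E = t%:E ->
  \sum_k kform (u k) (u k) <= t.
Proof.
move=> et; set nA := Num.sqrt (ip mu2 A A).
have nA0 : 0 <= nA by exact: sqrtr_ge0.
have Ft (F : {fset I}) : \sum_(i <- F) kform (e i) (e i) <= t.
  rewrite -lee_fin -et -sumEFin; apply: esum_ge; exists [set` F].
    by split => //; exact: finite_fset.
  by rewrite fsbig_finite//= set_fsetK.
have t0 : 0 <= t by have := Ft fset0; rewrite big_seq_fset0.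
apply/ler_addgt0Pr => eps eps0.
(* s and del split eps between the factor 1 + s and the remainders. *)
pose s := eps / (2 * (t + 1)).
have s0 : 0 < s by rewrite divr_gt0// mulr_gt0// ltr_wpDl.
pose B := (1 + s^-1) * (#|K|%:R * nA) + 1.
have B0 : 0 < B by rewrite ltr_wpDl// mulr_ge0 ?mulr_ge0// addr_ge0// invr_ge0 ltW.
pose del := eps / (2 * B).
have del0 : 0 < del by rewrite divr_gt0// mulr_gt0.
have /choice[F0 F0P] : forall k, exists F0 : {fset I}, forall F, (F0 `<=` F)%fset ->
    ip mu (u k - projection mu e F (u k)) (u k - projection mu e F (u k)) <= del.
  by move=> k; apply: projection_approx => //; case: eB.
pose F := \big[fsetU/fset0]_(k : K) F0 k.
have FP k := F0P k F (bigfcup_sup _ (mem_index_enum k) isT).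
pose p k := projection mu e F (u k); pose r k := u k - p k.
have p2 k : p k \in L2 by exact: L2_projection.
have r2 k : r k \in L2 by exact: L2B.
have pr : \sum_k kform (u k) (u k) <=
    (1 + s) * (\sum_k kform (p k) (p k)) + (1 + s^-1) * (\sum_k kform (r k) (r k)).
  rewrite !mulr_sumr -big_split/=; apply: ler_sum => k _.
  have := kform_young s0 (p2 k) (r2 k); rewrite /r.
  by rewrite (_ : p k + (u k - p k) = u k)// addrC subrK.
have rb : \sum_k kform (r k) (r k) <= #|K|%:R * nA * del.
  rewrite -mulrA mulr_natl -sumr_const; apply: ler_sum => k _.
  by apply: le_trans (kform_le (r2 k)) _; rewrite ler_wpM2l//; exact: FP.
have pb : \sum_k kform (p k) (p k) <= t by apply: le_trans (trace_projections F) (Ft F).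
have s1 : s * t <= eps / 2.
  rewrite /s mulrAC ler_pdivrMr ?mulr_gt0 ?ltr_wpDl//.
  by rewrite (_ : eps / 2 * (2 * (t + 1)) = eps * t + eps); [lra|field].
have s2 : (1 + s^-1) * (#|K|%:R * nA * del) <= eps / 2.
  have -> : (1 + s^-1) * (#|K|%:R * nA * del) = (B - 1) * del by rewrite /B; ring.
  apply: (@le_trans _ _ (B * del)); first by rewrite ler_wpM2r ?ltW//; lra.
  by rewrite (_ : B * del = eps / 2)// /del; field; rewrite gt_eqF.
have : (1 + s^-1) * (\sum_k kform (r k) (r k)) <= eps / 2.
  by apply: le_trans s2; rewrite ler_wpM2l// addr_ge0// invr_ge0 ltW.
have : (1 + s) * (\sum_k kform (p k) (p k)) <= (1 + s) * t.
  by rewrite ler_wpM2l// addr_ge0// ltW.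
lra.
Qed.

End trace.

End kernel_form.

(** * Step kernels *)

Section step_maps.
Context d (V : measurableType d) (R : realType).
Variable mu : {finite_measure set V -> \bar R}.
Local Notation mu2 := (square_measure mu).
Local Notation L2 := (Lfun mu 2%:E).

Definition cell (I : finType) (c : V -> I) k : set V := [set x | c x = k].

(** A finite measurable partition of V is given by the map c sending a point to
    the label of its cell. *)
Definition step_map (I : finType) (c : V -> I) := forall k, measurable (cell c k).

Section one_step_map.
Variables (I : finType) (c : V -> I).
Hypothesis mc : step_map c.

Definition ind k : V -> R := \1_(cell c k).
Definition mass k : R := fine (mu (cell c k)).
Definition step_kernel (g : I -> I -> R) : V * V -> R := fun p => g (c p.1) (c p.2).

Lemma indE k x : ind k x = (c x == k)%:R.
Proof.
rewrite /ind indicE; congr (nat_of_bool _)%:R; apply/idP/eqP; rewrite inE//.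
Qed.

Lemma L2_ind k : ind k \in L2.
Proof. exact: L2_indic. Qed.

Lemma mass_ge0 k : 0 <= mass k.
Proof. exact: fine_ge0. Qed.

Lemma ip_ind k l : ip mu (ind k) (ind l) = (k == l)%:R * mass k.
Proof.
rewrite ip_indic_indic//; have [<-|kl] := eqVneq; first by rewrite setIid mul1r.
rewrite (_ : _ `&` _ = set0) ?measure0 ?mul0r//.
apply/seteqP; split => // x [xk xl]; move/eqP: kl; apply.
by rewrite -[LHS]xk -[RHS]xl.
Qed.

Lemma step_funE (a : I -> R) : a \o c = \sum_k a k *: ind k.
Proof.
apply/funext => x; rewrite lincombE (bigD1 (c x))//= indE eqxx mulr1 big1 ?addr0//.
by move=> k kc; rewrite indE eq_sym (negbTE kc) mulr0.
Qed.

Lemma L2_step_fun (a : I -> R) : a \o c \in L2.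
Proof. by rewrite step_funE; apply: L2_lincomb; exact: L2_ind. Qed.

Lemma ip_step_fun (a b : I -> R) :
  ip mu (a \o c) (b \o c) = \sum_k a k * b k * mass k.
Proof.
rewrite !step_funE ip_suml//; [|exact: L2_ind|by apply: L2_lincomb; exact: L2_ind].
apply: eq_bigr => k _; rewrite ip_sumr; [|exact: L2_ind|exact: L2_ind].
rewrite (bigD1 k)//= big1 ?addr0 ?ip_ind ?eqxx ?mul1r ?mulrA// => l lk.
by rewrite ip_ind eq_sym (negbTE lk) mul0r mulr0.
Qed.

Lemma step_kernelE g :
  step_kernel g = \sum_k \sum_l g k l *: tensor (ind k) (ind l).
Proof.
apply/funext => p; rewrite fct_sumE (bigD1 (c p.1))//= [X in _ = _ + X]big1.
  rewrite addr0 lincombE (bigD1 (c p.2))//= /tensor !indE !eqxx !mulr1 big1 ?addr0//.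
  by move=> l lc; rewrite !indE [c p.2 == l]eq_sym (negbTE lc) !mulr0.
move=> k kc; rewrite lincombE big1// => l _; rewrite /tensor indE eq_sym (negbTE kc).
by rewrite mul0r mulr0.
Qed.

Lemma L2_tensor_ind k l : tensor (ind k) (ind l) \in Lfun mu2 2%:E.
Proof. by apply: L2_tensor; exact: L2_ind. Qed.

Lemma L2_step_kernel g : step_kernel g \in Lfun mu2 2%:E.
Proof.
rewrite step_kernelE; apply: L2_sum => k; apply: L2_lincomb => l.
exact: L2_tensor_ind.
Qed.

Lemma ip_step_kernel F g : F \in Lfun mu2 2%:E ->
  ip mu2 F (step_kernel g) =
  \sum_k \sum_l g k l * ip mu2 F (tensor (ind k) (ind l)).
Proof.
move=> F2; rewrite step_kernelE.
rewrite (eq_bigr (fun k => 1 *: \sum_l g k l *: tensor (ind k) (ind l))) => [|k _];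
  last by rewrite scale1r.
rewrite ip_sumr//; last by move=> k; apply: L2_lincomb => l; exact: L2_tensor_ind.
by apply: eq_bigr => k _; rewrite mul1r ip_sumr// => l; exact: L2_tensor_ind.
Qed.

Lemma ip_step_kernels g h :
  ip mu2 (step_kernel g) (step_kernel h) = \sum_k \sum_l g k l * h k l * (mass k * mass l).
Proof.
rewrite ip_step_kernel ?L2_step_kernel//; apply: eq_bigr => k _; apply: eq_bigr => l _.
rewrite ipC ip_step_kernel ?L2_tensor_ind// (bigD1 k)//= [X in _ + X]big1 ?addr0.
  rewrite (bigD1 l)//= [X in _ + X]big1 ?addr0.
    by rewrite ip_tensor ?L2_ind// !ip_ind !eqxx !mul1r; ring.
  by move=> j jl; rewrite ip_tensor ?L2_ind// !ip_ind [l == j]eq_sym (negbTE jl) mul0r !mulr0.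
by move=> i ik; rewrite big1// => j _; rewrite ip_tensor ?L2_ind// ip_ind [k == i]eq_sym (negbTE ik) !mul0r mulr0.
Qed.

Lemma ip_step_tensor g f : f \in L2 ->
  ip mu2 (step_kernel g) (tensor f f) =
  \sum_k \sum_l g k l * (ip mu f (ind k) * ip mu f (ind l)).
Proof.
move=> f2; rewrite ipC ip_step_kernel ?L2_tensor//; apply: eq_bigr => k _.
by apply: eq_bigr => l _; rewrite ip_tensor// L2_ind.
Qed.

(** Labels of null cells yield the zero function, the inverse of 0 being 0; so
    null cells drop out of all sums below. *)
Definition normalized_ind k : V -> R := (Num.sqrt (mass k))^-1 *: ind k.

(** On each cell this is the Cauchy-Schwarz inequality. *)
Lemma normalized_ind_bessel f : f \in L2 ->
  \sum_k ip mu (normalized_ind k) f ^+ 2 <= ip mu f f.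
Proof.
move=> f2; have fk2 k : f * ind k \in L2 by exact: L2_mul_indic.
apply: (@le_trans _ _ (\sum_k ip mu (f * ind k) (f * ind k))).
  apply: ler_sum => k _; rewrite ipZl ?L2_ind// exprMn exprVn sqr_sqrtr ?mass_ge0//.
  have [m0|m0] := eqVneq (mass k) 0; first by rewrite m0 invr0 mul0r ip_ge0.
  rewrite mulrC ler_pdivrMr ?lt_def ?m0 ?mass_ge0//.
  have -> : ip mu (ind k) f = ip mu (f * ind k) (ind k).
    apply: eq_Rintegral => x _; rewrite !fctE !indE.
    by case: (_ == _) => /=; rewrite ?mul1r ?mul0r ?mulr1 ?mulr0.
  by apply: le_trans (cauchy_schwarz (fk2 k) (L2_ind k)) _; rewrite ip_ind eqxx mul1r.
rewrite -Rintegral_sum; last by move=> k; exact: L2_mul_integrable.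
rewrite le_eqVlt; apply/orP; left; apply/eqP; apply: eq_Rintegral => x _.
rewrite (bigD1 (c x))//= big1 ?addr0 ?fctE ?indE ?eqxx ?mulr1// => k kc.
by rewrite !fctE indE eq_sym (negbTE kc) mulr0 mul0r.
Qed.

End one_step_map.

End step_maps.

(** * Approximating a measurable set by rectangles *)

Section rectangles.
Context d (V : measurableType d) (R : realType).
Variable mu : {finite_measure set V -> \bar R}.
Local Notation mu2 := (square_measure mu).
Implicit Types X Y : set (V * V).

Definition indicator_kernel (I : finType) (c : V -> I) (h : rel I) : V * V -> R :=
  step_kernel c (fun k l => (h k l)%:R).

Definition rectangle_approximable X := forall eps : R, 0 < eps ->
  exists (I : finType) (c : V -> I) (h : rel I), step_map c /\
    nrm mu2 (\1_X - indicator_kernel c h) ^+ 2 <= eps.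

Lemma step_map_pair (I J : finType) (c : V -> I) (c' : V -> J) :
  step_map c -> step_map c' -> step_map (fun x => (c x, c' x)).
Proof.
move=> mc mc' [k l]; rewrite (_ : cell _ _ = cell c k `&` cell c' l).
  exact: measurableI.
by apply/seteqP; split=> x; rewrite /cell/=; [case=> -> ->|case=> -> ->].
Qed.

Lemma step_map_mem (B : set V) : measurable B -> step_map (fun x => x \in B).
Proof.
move=> mB k; have -> : cell (fun x => x \in B) k = if k then B else ~` B.
  case: k; apply/seteqP; split=> x; rewrite /cell/=.
  - exact: set_mem.
  - exact: mem_set.
  - by move/negbT; rewrite notin_setE.
  - exact: memNset.
by case: k => //; exact: measurableC.
Qed.

Lemma rectangle_approximableX (B C : set V) : measurable B -> measurable C ->
  rectangle_approximable (B `*` C).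
Proof.
move=> mB mC eps eps0; pose c x := (x \in B, x \in C).
exists (bool * bool)%type, c, (fun k l => k.1 && l.2); split.
  by apply: step_map_pair; exact: step_map_mem.
rewrite (_ : _ - _ = 0) ?nrm_sqr ?ip0l ?ltW//.
apply/funext => p; rewrite !fctE /indicator_kernel /step_kernel !indicE in_setX.
by rewrite /c/= subrr.
Qed.

Lemma rectangle_approximable0 : rectangle_approximable set0.
Proof.
have := @rectangle_approximableX setT set0 measurableT measurable0.
by rewrite setX0.
Qed.

Lemma L2_indicator_kernel (I : finType) (c : V -> I) (h : rel I) :
  step_map c -> indicator_kernel c h \in Lfun mu2 2%:E.
Proof. by move=> mc; exact: L2_step_kernel. Qed.

Lemma rectangle_approximableC X : rectangle_approximable X ->
  rectangle_approximable (~` X).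
Proof.
move=> aX eps /aX[I [c [h [mc Xch]]]].
exists I, c, (fun k l => ~~ h k l); split=> //; apply: le_trans Xch.
rewrite !nrm_sqr le_eqVlt; apply/orP; left; apply/eqP; apply: eq_Rintegral => p _.
rewrite !fctE /indicator_kernel /step_kernel !indicE in_setC.
by case: (p \in X); case: (h _ _); rewrite /=; ring.
Qed.

Lemma rectangle_approximableU X Y : measurable X -> measurable Y ->
  rectangle_approximable X -> rectangle_approximable Y ->
  rectangle_approximable (X `|` Y).
Proof.
move=> mX mY aX aY eps eps0; have e20 : 0 < eps / 2 by rewrite divr_gt0.
have [I [c [h [mc Xch]]]] := aX _ e20; have [J [c' [h' [mc' Ych]]]] := aY _ e20.
have mcc := step_map_pair mc mc'.
exists (I * J)%type, (fun x => (c x, c' x)), (fun k l => h k.1 l.1 || h' k.2 l.2); split=> //.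
rewrite (splitr eps); apply: le_trans (lerD Xch Ych); rewrite !nrm_sqr.
apply: ip_le_sum.
- by apply: L2B; [apply: L2_indic; exact: measurableU|exact: L2_indicator_kernel].
- by apply: L2B; [exact: L2_indic|exact: L2_indicator_kernel].
- by apply: L2B; [exact: L2_indic|exact: L2_indicator_kernel].
move=> p; rewrite !fctE /indicator_kernel /step_kernel/= !indicE in_setU.
by case: (p \in X); case: (p \in Y); case: (h _ _); case: (h' _ _) => /=;
  rewrite !(subrr, subr0, sub0r, sqrrN, expr0n, expr1n)/=; lra.
Qed.

Lemma rectangle_approximable_bigcup (F : nat -> set (V * V)) :
  (forall n, measurable (F n)) -> (forall n, rectangle_approximable (F n)) ->
  rectangle_approximable (\bigcup_n F n).
Proof.
move=> mF aF; set X := \bigcup_n F n.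
pose Y n := \big[setU/set0]_(i < n) F i.
have mX : measurable X by exact: bigcupT_measurable.
have mY n : measurable (Y n) by apply: bigsetU_measurable.
have YX n : Y n `<=` X by move=> p; rewrite /Y -bigcup_mkord => -[k _ Fk]; exists k.
have aY n : rectangle_approximable (Y n).
  elim: n => [|n IH].
    by rewrite /Y big_ord0; exact: rectangle_approximable0.
  by rewrite /Y big_ord_recr/=; exact: rectangle_approximableU (mY n) (mF n) IH (aF n).
have XY0 : fine (mu2 (X `\` Y n)) @[n --> \oo] --> (0 : R).
  apply: cvg_measure_empty => [n|i j ij|].
  - exact: measurableD.
  - apply/subsetPset => p [Xp nYj]; split=> // Yi; apply: nYj.
    move: Yi; rewrite /Y -!bigcup_mkord => -[k /= ki Fk]; exists k => //=.
    exact: leq_trans ij.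
  - apply/seteqP; split => // p Dp; have [[k _ Fk] _] := Dp 0%N I.
    have [_ nY] := Dp k.+1 I; apply: nY; rewrite /Y -bigcup_mkord.
    by exists k => /=.
move=> eps eps0; have e4 : 0 < eps / 4 by rewrite divr_gt0.
have /cvgrPdist_le/(_ _ e4)[n _ /(_ n (leqnn n))] := XY0.
rewrite /= sub0r normrN ger0_norm ?fine_ge0// => Yn.
have [I [c [h [mc Ych]]]] := aY n _ e4.
exists I, c, h; split=> //.
have XY2 : \1_X - \1_(Y n) \in Lfun mu2 2%:E by apply: L2B; exact: L2_indic.
have Yc2 : \1_(Y n) - indicator_kernel c h \in Lfun mu2 2%:E.
  by apply: L2B; [exact: L2_indic|exact: L2_indicator_kernel].
have XYn : nrm mu2 (\1_X - \1_(Y n)) ^+ 2 <= eps / 4.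
  apply: le_trans Yn; rewrite nrm_sqr -[X in fine (mu2 X)]setIid.
  rewrite -ip_indic_indic; [|exact: measurableD..].
  rewrite le_eqVlt; apply/orP; left; apply/eqP; apply: eq_Rintegral => p _.
  rewrite !fctE !indicE in_setD; have [pY|pY] := boolP (p \in Y n).
    rewrite mem_set; first by rewrite /= subrr ?mulr0 ?mul0r.
    by apply: (YX n); exact: set_mem.
  by rewrite andbT; case: (_ \in _); rewrite /= subr0.
have := nrmD XY2 Yc2; rewrite addrA subrK => H.
have H2 : nrm mu2 (\1_X - indicator_kernel c h) ^+ 2 <=
    (nrm mu2 (\1_X - \1_(Y n)) + nrm mu2 (\1_(Y n) - indicator_kernel c h)) ^+ 2.
  by rewrite ler_sqr ?nnegrE ?addr_ge0 ?nrm_ge0.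
apply: le_trans H2 _; move: XYn Ych.
have := sqr_ge0 (nrm mu2 (\1_X - \1_(Y n)) - nrm mu2 (\1_(Y n) - indicator_kernel c h)).
rewrite sqrrB sqrrD; lra.
Qed.

(** The approximable measurable sets form a sigma-algebra containing the
    rectangles: a union of two of them is approximated along the common
    refinement of the partitions, a countable union by its finite subunions. *)
Lemma measurable_rectangle_approximable X : measurable X -> rectangle_approximable X.
Proof.
suff : measurable `<=` [set X | measurable X /\ rectangle_approximable X].
  by move=> H /H[].
rewrite [X in X `<=` _]measurable_prod_measurableType; apply: smallest_sub.
  split=> /=.
  - by split=> //; exact: rectangle_approximable0.
  - move=> B [mB aB]; rewrite setTD; split; first exact: measurableC.
    exact: rectangle_approximableC.
  - move=> F aF; split; first by apply: bigcupT_measurable => n; case: (aF n).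
    by apply: rectangle_approximable_bigcup => n; case: (aF n).
move=> _ [B mB [C mC <-]]; split; first exact: measurableX.
exact: rectangle_approximableX.
Qed.

(** Intersecting an approximation with its transpose at most doubles the squared
    distance to a symmetric set, because mu2 is invariant under the swap. *)
Lemma symmetric_rectangle_approximation X (eps : R) : measurable X ->
  (forall x y, X (x, y) -> X (y, x)) -> 0 < eps ->
  exists (I : finType) (c : V -> I) (h : rel I), [/\ step_map c, symmetric h &
    nrm mu2 (\1_X - indicator_kernel c h) <= eps].
Proof.
move=> mX symX eps0; have e20 : 0 < eps ^+ 2 / 2 by rewrite divr_gt0// exprn_gt0.
have [I [c [h [mc Xch]]]] := measurable_rectangle_approximable mX e20.
exists I, c, (fun k l => h k l && h l k); split=> //.
  by move=> k l; rewrite andbC.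
rewrite -ler_sqr ?nnegrE ?nrm_ge0//; last exact: ltW.
have D2 : \1_X - indicator_kernel c h \in Lfun mu2 2%:E.
  by apply: L2B; [exact: L2_indic|exact: L2_indicator_kernel].
have Xswap p : ((swap p) \in X) = (p \in X).
  by case: p => x y; apply/idP/idP; rewrite !inE => /symX.
have D2s : (\1_X - indicator_kernel c h) \o @swap _ V \in Lfun mu2 2%:E.
  have -> : (\1_X - indicator_kernel c h) \o @swap _ V =
      \1_X - indicator_kernel c (fun k l => h l k).
    by apply/funext => p; rewrite /= !fctE !indicE Xswap.
  by apply: L2B; [exact: L2_indic|exact: L2_indicator_kernel].
rewrite (splitr (eps ^+ 2)); apply: le_trans (lerD Xch Xch).
rewrite !nrm_sqr -[X in _ <= _ + X]ip_swap//; apply: ip_le_sum => //.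
  by apply: L2B; [exact: L2_indic|exact: L2_indicator_kernel].
move=> p; rewrite /= !fctE !indicE Xswap /indicator_kernel /step_kernel/=.
by case: (p \in X); case: (h (c p.1) _); case: (h (c p.2) _) => /=;
  rewrite !(subrr, subr0, sub0r, sqrrN, expr0n, expr1n)/=; lra.
Qed.

End rectangles.

(** * Trace class kernels tested against step kernels *)

Lemma sum_cauchy_schwarz (R : realFieldType) (J : finType) (x y : J -> R) :
  (\sum_j x j * y j) ^+ 2 <= (\sum_j x j ^+ 2) * (\sum_j y j ^+ 2).
Proof.
apply: discriminant_le0 => [|t]; first by apply: sumr_ge0 => j _; exact: sqr_ge0.
rewrite (_ : _ + _ = \sum_j (x j - t * y j) ^+ 2).
  by apply: sumr_ge0 => j _; exact: sqr_ge0.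
rewrite !mulr_sumr -sumrB -big_split/=; apply: eq_bigr => j _; ring.
Qed.

Section trace_class_kernel.
Context d (V : measurableType d) (R : realType).
Variable mu : {finite_measure set V -> \bar R}.
Local Notation mu2 := (square_measure mu).
Variables (A : V * V -> R) (t : R).
Hypothesis A2 : A \in Lfun mu2 2%:E.
Hypothesis Asym : {ae mu2, forall p, A p = A (p.2, p.1)}.
Hypothesis Apsd : psd mu A.
Hypothesis Atr : trace_class_with_trace mu A t.

Lemma trace_ge0 : 0 <= t.
Proof.
have [J [e [[e2 _ _] et]]] := Atr.
by rewrite -lee_fin -et; apply: esum_ge0 => i _; rewrite lee_fin; exact: Apsd.
Qed.

Section step.
Variables (I : finType) (c : V -> I).
Hypothesis mc : step_map c.
Local Notation ind := (ind R c).
Local Notation mass := (mass mu c).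
Local Notation a := (fun k l => kform mu A (ind k) (ind l)).

(** The normalized indicators of the cells satisfy Bessel's inequality, so their
    diagonal coefficients sum to at most the trace. *)
Lemma trace_cells : \sum_k kform mu A (ind k) (ind k) / mass k <= t.
Proof.
have ind2 k : ind k \in Lfun mu 2%:E by exact: L2_ind.
have [J [e [eB et]]] := Atr.
have := @trace_bessel _ _ _ mu A A2 Asym Apsd J e eB I (normalized_ind mu c)
  (fun k => L2Z _ (ind2 k)) (fun f => normalized_ind_bessel mc (f := f)) t et.
apply: le_trans; apply: ler_sum => k _.
by rewrite kformZl ?kformZr ?L2Z// mulrA -expr2 exprVn sqr_sqrtr ?mass_ge0// mulrC.
Qed.

Let ind2 k : ind k \in Lfun mu 2%:E. Proof. exact: L2_ind. Qed.

Let a_psd v : 0 <= qform a v v.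
Proof. by rewrite qform_kform//; apply: kform_ge0 => //; exact: L2_lincomb. Qed.

Let a_sym k l : a k l = a l k. Proof. exact: kformC. Qed.

Let a_null k : mass k = 0 -> a k k = 0.
Proof.
move=> mk; apply/eqP; rewrite eq_le (psd_diag_ge0 a_psd) andbT.
by have := kform_le A2 (ind2 k); rewrite ip_ind// mk !mulr0.
Qed.

(** With a_kl = kform (ind k) (ind l), positivity gives a_kl^2 <= a_kk a_ll, so the
    squared norm sum_kl a_kl^2 / (mass k mass l) of the projection of A on the
    step kernels is at most (sum_k a_kk / mass k)^2 <= t^2. *)
Lemma step_kernel_bound g :
  `|ip mu2 A (step_kernel c g)| <= t * nrm mu2 (step_kernel c g).
Proof.
have d0 k : 0 <= a k k / mass k by rewrite divr_ge0 ?mass_ge0// (psd_diag_ge0 a_psd).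
have t0 := trace_ge0.
rewrite -ler_sqr ?nnegrE ?mulr_ge0 ?nrm_ge0// real_normK ?num_real// exprMn nrm_sqr.
pose s k := Num.sqrt (mass k).
have s2 k : s k ^+ 2 = mass k by rewrite sqr_sqrtr// mass_ge0.
have -> : ip mu2 A (step_kernel c g) =
    \sum_(p : I * I) (g p.1 p.2 * (s p.1 * s p.2)) * (a p.1 p.2 / (s p.1 * s p.2)).
  rewrite ip_step_kernel// pair_big/=; apply: eq_bigr => p _; rewrite -/(a p.1 p.2).
  rewrite -mulrA; congr (_ * _).
  have [|s0] := eqVneq (s p.1 * s p.2) 0; last by rewrite mulrCA divff// mulr1.
  move=> s0; rewrite s0 mul0r; move/eqP: s0; rewrite mulf_eq0.
  have z k : s k == 0 -> a k k = 0 by move=> /eqP sk; apply: a_null; rewrite -s2 sk expr0n.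
  by move=> /orP[]/z ak; [rewrite [LHS]a_sym|]; exact: (psd_row0 a_sym a_psd).
apply: le_trans (sum_cauchy_schwarz _ _) _; rewrite mulrC.
have -> : ip mu2 (step_kernel c g) (step_kernel c g) =
    \sum_(p : I * I) (g p.1 p.2 * (s p.1 * s p.2)) ^+ 2.
  rewrite ip_step_kernels// pair_big/=; apply: eq_bigr => p _.
  by rewrite -!s2; ring.
apply: ler_wpM2r; first by apply: sumr_ge0 => p _; exact: sqr_ge0.
apply: (@le_trans _ _ ((\sum_k a k k / mass k) ^+ 2)); last first.
  by rewrite ler_sqr ?nnegrE// ?sumr_ge0//; exact: trace_cells.
rewrite expr2 mulr_suml; under [leRHS]eq_bigr do rewrite mulr_sumr.
rewrite [leRHS]pair_big/=; apply: ler_sum => p _.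
rewrite expr_div_n exprMn !s2 [leRHS]mulrACA -invfM ler_wpM2r//.
  by rewrite invr_ge0 mulr_ge0 ?mass_ge0.
exact: (psd_entry_le a_sym a_psd).
Qed.

End step.

(** Approximate X by a union of rectangles W' of another partition: on the common
    refinement W' - W is a step kernel, and the error 1_X - W' is negligible in L2. *)
Lemma indicator_kernel_bound (X : set (V * V)) (I : finType) (c : V -> I) (h : rel I) :
  measurable X -> step_map c ->
  `|ip mu2 A (\1_X - indicator_kernel R c h)| <=
  t * nrm mu2 (\1_X - indicator_kernel R c h).
Proof.
move=> mX mc; set W := indicator_kernel R c h.
have X2 : \1_X \in Lfun mu2 2%:E by exact: L2_indic.
have W2 : W \in Lfun mu2 2%:E by exact: L2_indicator_kernel.
have t0 := trace_ge0.
apply/ler_addgt0Pr => eps eps0.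
pose K := nrm mu2 A + t + 1.
have K0 : 0 < K by rewrite ltr_wpDl// addr_ge0 ?nrm_ge0.
have eK : 0 < (eps / K) ^+ 2 by rewrite exprn_gt0// divr_gt0.
have [J [c' [h' [mc' Xch]]]] := measurable_rectangle_approximable mu mX eK.
set W' := indicator_kernel R c' h' in Xch.
have {}Xch : nrm mu2 (\1_X - W') <= eps / K.
  by rewrite -ler_sqr ?nnegrE ?nrm_ge0// ltW// divr_gt0.
have W2' : W' \in Lfun mu2 2%:E by exact: L2_indicator_kernel.
have DE : W' - W = step_kernel (fun x => (c' x, c x))
    (fun k l => (h' k.1 l.1)%:R - (h k.2 l.2)%:R) by [].
have := step_kernel_bound (step_map_pair mc' mc) (fun k l => (h' k.1 l.1)%:R - (h k.2 l.2)%:R).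
rewrite -DE => H1.
have H2 := ip_le_nrm A2 (L2B X2 W2').
have H3 : nrm mu2 (W' - W) <= eps / K + nrm mu2 (\1_X - W).
  rewrite (_ : W' - W = (\1_X - W) + (- 1) *: (\1_X - W')).
    apply: le_trans (nrmD (L2B X2 W2) (L2Z _ (L2B X2 W2'))) _; rewrite addrC lerD2r.
    by rewrite /nrm ipZl ?ipZr ?L2Z ?L2B// mulrA mulrNN !mul1r.
  by rewrite scaleN1r; apply/funext => p; rewrite !fctE; ring.
rewrite (_ : \1_X - W = (\1_X - W') + (W' - W)); last by rewrite addrA subrK.
rewrite {1}ipDr ?L2B//; apply: le_trans (ler_normD _ _) _.
rewrite addrA subrK.
apply: le_trans (lerD H2 H1) _.
have E1 : nrm mu2 A * nrm mu2 (\1_X - W') <= nrm mu2 A * (eps / K) by rewrite ler_wpM2l ?nrm_ge0.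
have E2 : t * nrm mu2 (W' - W) <= t * (eps / K + nrm mu2 (\1_X - W)) by rewrite ler_wpM2l.
have E3 : K * (eps / K) = eps by rewrite mulrC divfK ?gt_eqF.
have e0 : 0 < eps / K by rewrite divr_gt0.
apply: le_trans (lerD E1 E2) _; rewrite mulrDr addrA -mulrDl addrC lerD2l.
by rewrite -[leRHS]E3 ler_wpM2r ?(ltW e0)// lerDl.
Qed.

End trace_class_kernel.

(** * Sets that span no edge, up to null sets *)

Section thick_graph.
Context d (V : measurableType d) (R : realType).
Variable mu : {finite_measure set V -> \bar R}.
Local Notation mu2 := (square_measure mu).
Variable E : set (V * V).
Hypothesis mE : measurable E.

Lemma shrinking_proper (DD : set (set V)) (v : V) : directed_at DD v -> ProperFilter (shrinking DD v).
Proof.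
move=> [[D0 D0v] dirD]; apply: filter_from_proper.
  apply: filter_from_filter; first by exists D0.
  move=> D1 D2 D1v D2v; have [D3 D3v D312] := dirD _ _ D1v D2v.
  exists D3 => // D [Dv DD3]; split; split=> //.
    by apply: subset_trans DD3 _; move=> x /D312[].
  by apply: subset_trans DD3 _; move=> x /D312[].
by move=> D Dv; exists D; split=> // x.
Qed.

Lemma shrinking_members (DD : set (set V)) (v : V) : directed_at DD v ->
  \forall D \near shrinking DD v, DD D.
Proof. by move=> [[D0 D0v] _]; exists D0 => // D [[]]. Qed.

(** Up to a null set, an edge from D1 to D2 leaves S at one of its ends. *)
Lemma rectangle_edge_density (S D1 D2 : set V) :
  measurable S -> mu2 (E `&` S `*` S) = 0%E -> nonnull mu D1 -> nonnull mu D2 ->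
  fine (mu2 (D1 `*` D2 `&` E)) / (fine (mu D1) * fine (mu D2)) <=
  (1 - fine (mu (D1 `&` S)) / fine (mu D1)) + (1 - fine (mu (D2 `&` S)) / fine (mu D2)).
Proof.
move=> mS ES0 [mD1 D10] [mD2 D20].
have pos D : mu D != 0%E -> measurable D -> 0 < fine (mu D).
  by move=> D0 mD; rewrite fine_gt0// lt_def D0 measure_ge0/= ltey_eq fin_num_measure.
have m1 := pos _ D10 mD1; have m2 := pos _ D20 mD2.
rewrite ler_pdivrMr ?mulr_gt0//.
have -> : (1 - fine (mu (D1 `&` S)) / fine (mu D1) + (1 - fine (mu (D2 `&` S)) / fine (mu D2)))
    * (fine (mu D1) * fine (mu D2)) =
    (fine (mu D1) - fine (mu (D1 `&` S))) * fine (mu D2) +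
    fine (mu D1) * (fine (mu D2) - fine (mu (D2 `&` S))).
  by field; rewrite !gt_eqF.
have dif D : measurable D -> fine (mu D) - fine (mu (D `&` S)) = fine (mu (D `\` S)).
  move=> mD; rewrite measureD// ?fineB ?fin_num_measure//; last 2 first.
  - exact: measurableI.
  - by rewrite ltey_eq fin_num_measure.
rewrite !dif// -!fineM ?fin_num_measure//; try exact: measurableD.
rewrite -!square_measureX//; try exact: measurableD.
have mX1 : measurable ((D1 `\` S) `*` D2) by apply: measurableX => //; exact: measurableD.
have mX2 : measurable (D1 `*` (D2 `\` S)) by apply: measurableX => //; exact: measurableD.
have mES : measurable (E `&` S `*` S) by apply: measurableI => //; exact: measurableX.
rewrite -fineD ?fin_num_measure// fine_le ?fin_num_measure//.
- by apply: measurableI => //; exact: measurableX.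
- by rewrite fin_numD !fin_num_measure.
rewrite -[leRHS]adde0 -[in leRHS]ES0.
apply: le_trans (_ : mu2 (((D1 `\` S) `*` D2 `|` D1 `*` (D2 `\` S)) `|` (E `&` S `*` S)) <= _)%E.
  apply: le_measure; rewrite ?inE.
  - by apply: measurableI => //; exact: measurableX.
  - by apply: measurableU => //; exact: measurableU.
  move=> [x y] [[/= D1x D2y] Exy].
  have [Sx|nSx] := pselect (S x); last by left; left.
  by have [Sy|nSy] := pselect (S y); [right|left; right].
apply: (le_trans (measureU2 mu2 (measurableU _ _ mX1 mX2) mES)).
exact: leeD2r (measureU2 mu2 mX1 mX2).
Qed.

(** An edge between two density points of S would have a positive limit density
    in small rectangles around it, whereas rectangle_edge_density lets this
    density tend to 0.  Removing from S a null set that contains its points that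
    are not density points leaves an independent set. *)
Lemma thick_independent_part (S : set V) : thick mu E -> measurable S ->
  mu S != 0%E -> mu2 (E `&` S `*` S) = 0%E ->
  exists I, [/\ measurable I, independent_set E I & mu I = mu S].
Proof.
move=> [DD [DDn DDdir DDd] DDE] mS S0 ES0.
have [N [mN N0 SN]] := DDd S (conj mS S0).
exists (S `\` N); split.
- exact: measurableD.
- move=> x y [Sx Nx] [Sy Ny] Exy.
  have dens z : S z -> ~ N z -> density_points mu DD S z.
    by move=> Sz Nz; apply: contrapT => nd; apply: Nz; apply: SN; left.
  have [l l0 /cvgrPdist_lt Hl] := DDE _ _ Exy.
  have FX := shrinking_proper (DDdir x); have FY := shrinking_proper (DDdir y).
  have l4 : 0 < l / 4 by rewrite divr_gt0.
  have /cvgrPdist_lt/(_ _ l4) Hx := dens x Sx Nx.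
  have /cvgrPdist_lt/(_ _ l4) Hy := dens y Sy Ny.
  have Px : \forall D \near shrinking DD x,
      (`|1 - fine (mu (D `&` S)) / fine (mu D)| : R) < l / 4 /\ DD D.
    exact: filterI Hx (shrinking_members (DDdir x)).
  have Py : \forall D \near shrinking DD y,
      (`|1 - fine (mu (D `&` S)) / fine (mu D)| : R) < l / 4 /\ DD D.
    exact: filterI Hy (shrinking_members (DDdir y)).
  have [[D1 D2] [[[h1 M1] [h2 M2]] h]] :=
    filter_ex (filterI (filterI (filter_prod1 (G := shrinking DD y) Px)
      (filter_prod2 (F := shrinking DD x) Py)) (Hl _ _ l4)).
  have := rectangle_edge_density mS ES0 (DDn _ M1) (DDn _ M2).
  move: h1 h2 h => /=; rewrite !ltr_norml => /andP[_ h1] /andP[_ h2] /andP[_ h]; lra.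
- rewrite measureD//; last by rewrite ltey_eq fin_num_measure.
  rewrite [X in (_ - X)%E](_ : _ = 0%E) ?sube0//.
  by apply: subset_measure0 N0 => //; exact: measurableI.
Qed.

End thick_graph.

(** * Coercivity off the independent sets *)

Lemma cvg_finite_sum (R : realType) (J : Type) (U : set_system J) (I : Type)
    (s : seq I) (f : I -> J -> R) (l : I -> R) : Filter U ->
  (forall i, f i j @[j --> U] --> l i) ->
  \sum_(i <- s) f i j @[j --> U] --> \sum_(i <- s) l i.
Proof.
move=> UF fl; elim: s => [|i s IH].
  by rewrite big_nil; under eq_fun do rewrite big_nil; exact: cvg_cst.
by rewrite big_cons; under eq_fun do rewrite big_cons; apply: cvgD.
Qed.

Section coercivity.
Context d (V : measurableType d) (R : realType).
Variable mu : {finite_measure set V -> \bar R}.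
Local Notation mu2 := (square_measure mu).
Local Notation L2 := (Lfun mu 2%:E).
Variable E : set (V * V).
Hypothesis mE : measurable E.

Definition edge_energy (f : V -> R) : R := ip mu2 \1_E (tensor f f).

Let E2 : \1_E \in Lfun mu2 2%:E. Proof. exact: L2_indic. Qed.

Lemma edge_energy_ge0 f : (forall x, 0 <= f x) -> 0 <= edge_energy f.
Proof. by move=> f0; apply: Rintegral_ge0 => p _; rewrite !mulr_ge0. Qed.

(** Cauchy-Schwarz in L2(mu2), where f (x) f has norm ||f||^2. *)
Lemma edge_energy_near (I : finType) (c : V -> I) (h : rel I) f :
  step_map c -> f \in L2 ->
  `|edge_energy f - ip mu2 (indicator_kernel R c h) (tensor f f)| <=
  nrm mu2 (\1_E - indicator_kernel R c h) * ip mu f f.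
Proof.
move=> mc f2; have W2 := L2_indicator_kernel mu h mc.
rewrite -ipBl ?L2_tensor//; apply: le_trans (ip_le_nrm (L2B E2 W2) (L2_tensor f2 f2)) _.
by rewrite /nrm [X in _ * Num.sqrt X]ip_tensor// -expr2 sqrtr_sqr ger0_norm ?ip_ge0.
Qed.

Lemma edge_energy_indic_le f S : measurable S -> f \in L2 -> (forall x, 0 <= f x) ->
  edge_energy (f * \1_S) <= edge_energy f.
Proof.
move=> mS f2 f0; apply: le_Rintegral => //.
- by apply: L2_mul_integrable => //; apply: L2_tensor; exact: L2_mul_indic.
- by apply: L2_mul_integrable => //; exact: L2_tensor.
move=> p _; apply: ler_wpM2l => //; rewrite /tensor !fctE !indicE.
by case: (_ \in _); case: (_ \in _); rewrite !(mulr1, mulr0, mul0r)// mulr_ge0.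
Qed.

Lemma ip_mul_indic f g S : ip mu (f * \1_S) g = ip mu f (g * \1_S).
Proof. by apply: eq_Rintegral => x _; rewrite !fctE; ring. Qed.

Lemma ip_mul_indic_le f S : measurable S -> f \in L2 ->
  ip mu (f * \1_S) (f * \1_S) <= ip mu f f.
Proof.
move=> mS f2; apply: le_Rintegral => //.
- by apply: L2_mul_integrable; exact: L2_mul_indic.
- exact: L2_mul_integrable.
move=> x _; rewrite !fctE indicE; case: (_ \in _); rewrite ?mulr1// !mulr0.
by rewrite -expr2 sqr_ge0.
Qed.

Lemma edge_energy_eq0 (g : V -> R) (S := [set x | 0 < g x]) : measurable S -> g \in L2 ->
  edge_energy (g * \1_S) = 0 -> mu2 (E `&` S `*` S) = 0%E.
Proof.
move=> mS g2 q0; have G2 : g * \1_S \in L2 by exact: L2_mul_indic.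
have mX : measurable (E `&` S `*` S) by apply: measurableI => //; exact: measurableX.
apply/(negligibleP mu2 mX).
have intF := L2_mul_integrable E2 (L2_tensor G2 G2).
have G0 x : 0 <= (g * \1_S) x.
  rewrite !fctE indicE; case: (boolP (x \in S)); rewrite ?mulr0// inE mulr1.
  exact: ltW.
have : (\int[mu2]_p `|(\1_E p * tensor (g * \1_S) (g * \1_S) p)%R%:E| = 0)%E.
  rewrite (eq_integral (EFin \o (\1_E \* tensor (g * \1_S) (g * \1_S)))); last first.
    by move=> p _; rewrite gee0_abs// lee_fin; apply: mulr_ge0 => //; apply: mulr_ge0.
  by have /(integrable_fin_num measurableT)/fineK <- := intF; rewrite -[RHS]/(0%:E) -q0.
move/(ae_eq_integral_abs _ measurableT (measurable_int _ intF)) => [N [mN N0 sN]].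
exists N; split=> // -[x y] [Exy [/= Sx Sy]]; apply: sN => /= /(_ I) [] /eqP.
rewrite /tensor/= !fctE !indicE !mem_set// !mulr1 mul1r mulf_eq0.
by rewrite !gt_eqF.
Qed.

(** Otherwise there are densities f_n with lam ||f_n||^2 < 1 whose edge energy
    tends to 0.  Let g be a weak limit and S = {g > 0}.  The masses of the f_n on S
    tend to at least 1, which forces mu(S) >= lam by Cauchy-Schwarz.  The energy
    of f_n (x) f_n on a union of rectangles converges to that of g (x) g, so
    approximating E by rectangles shows that g restricted to S has no edge
    energy.  By thickness S then has an independent subset of measure mu(S). *)
Lemma coercivity (lam : R) : thick mu E -> (independence_number mu E < lam%:E)%E ->
  exists2 M, 0 <= M & forall f, f \in L2 -> (forall x, 0 <= f x) -> ip mu f 1 = 1 ->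
    1 <= lam * ip mu f f + M * edge_energy f.
Proof.
move=> Ethick alam.
have alpha_ge S : measurable S -> independent_set E S ->
    (mu S <= independence_number mu E)%E.
  by move=> mS iS; apply: ereal_sup_ubound; exists S.
have lam0 : 0 < lam.
  rewrite -lte_fin; apply: le_lt_trans alam.
  by have := alpha_ge set0 measurable0; rewrite measure0; apply.
apply: contrapT => H.
have /choice[f fP] : forall n : nat, exists f, [/\ f \in L2, forall x, 0 <= f x,
    ip mu f 1 = 1 & lam * ip mu f f + n%:R * edge_energy f < 1].
  move=> n; apply: contrapT => Hn; apply: H; exists n%:R => // f f2 f0 f1.
  by rewrite leNgt; apply/negP => fn; apply: Hn; exists f.
have f2 n : f n \in L2 by case: (fP n).
have f0 n x : 0 <= f n x by case: (fP n).
have f1 n : ip mu (f n) 1 = 1 by case: (fP n).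
have q0 n : 0 <= edge_energy (f n) by exact: edge_energy_ge0.
have fb n : ip mu (f n) (f n) <= lam^-1.
  rewrite -[leRHS]mul1r ler_pdivlMr// mulrC; case: (fP n) => _ _ _ /ltW.
  by apply: le_trans; rewrite lerDl mulr_ge0.
have fq n : n%:R * edge_energy (f n) <= 1.
  case: (fP n) => _ _ _ /ltW; apply: le_trans.
  by rewrite lerDr mulr_ge0 ?ip_ge0// ltW.
have [U [UU oU]] := ultraFilterLemma eventually_filter.
have UP : ProperFilter U by exact: ultra_proper.
have [g g2 fg] := weak_ultralimit UU f2 fb.
have one2 : (1 : V -> R) \in L2 by exact: L2_cst1.
pose S := [set x | 0 < g x].
have mS : measurable S.
  rewrite -[S]setTI (_ : S = g @^-1` [set` `]0, +oo[ ]).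
    by apply: (L2_measurable g2) => //; exact: measurable_itv.
  by apply/seteqP; split=> x /=; rewrite in_itv/= andbT.
have S2 : (\1_S : V -> R) \in L2 by exact: L2_indic.
have gS1 : 1 <= ip mu g \1_S.
  have -> : \1_S = 1 - \1_(~` S) :> (V -> R).
    apply/funext => x; rewrite !fctE !indicE in_setC.
    by case: (x \in S); rewrite /= ?subr0 ?subrr.
  rewrite ipBr//; last by apply: L2_indic; exact: measurableC.
  have -> : ip mu g 1 = 1.
    have := fg _ one2; under eq_fun do rewrite f1.
    by move=> /(cvg_lim (@Rhausdorff R)); rewrite lim_cst.
  rewrite lerBrDr -subr_ge0 opprD addrA subrr sub0r -mulN1r -ipZl ?L2_indic//; last first.
    exact: measurableC.
  apply: Rintegral_ge0 => x _; rewrite !fctE indicE in_setC.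
  have [xS|xS] := boolP (x \in S); first by rewrite mulr0.
  rewrite mulr1 [_ *: _]mulN1r oppr_ge0 leNgt; apply: contra xS => xS.
  by rewrite inE.
have muS : lam <= fine (mu S).
  have gS : ip mu g \1_S <= Num.sqrt (lam^-1 * fine (mu S)).
    rewrite -(cvg_lim (@Rhausdorff R) (fg _ S2)); apply: limr_le; first exact: cvgP (fg _ S2).
    apply: nearW => n; apply: le_trans (ler_norm _) _; apply: le_sqr_sqrt.
    apply: le_trans (cauchy_schwarz (f2 n) S2) _.
    by rewrite ip_indic_indic// setIid ler_wpM2r// fine_ge0.
  have := le_trans gS1 gS; rewrite -[X in X <= _](sqrtr1 R) ler_sqrt.
    by rewrite mulrC ler_pdivlMr// mul1r.
  by rewrite mulr_ge0 ?fine_ge0// invr_ge0 ltW.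
pose F n := f n * \1_S; pose G := g * \1_S.
have F2 n : F n \in L2 by exact: L2_mul_indic.
have G2 : G \in L2 by exact: L2_mul_indic.
have FG h : h \in L2 -> ip mu (F n) h @[n --> U] --> ip mu G h.
  move=> h2; rewrite /G ip_mul_indic; under eq_fun do rewrite /F ip_mul_indic.
  by apply: fg; exact: L2_mul_indic.
have G0 : edge_energy G = 0.
  apply: (@eq0_arbitrarily_small _ _ (lam^-1 + 1 + ip mu G G)) => eps eps0.
  rewrite ger0_norm; last first.
    apply: edge_energy_ge0 => x; rewrite /G !fctE indicE.
    case: (boolP (x \in S)); rewrite ?mulr0// inE mulr1; exact: ltW.
  have [I [c [h [mc Eh]]]] := measurable_rectangle_approximable mu mE
    (exprn_gt0 2 eps0).
  have {}Eh : nrm mu2 (\1_E - indicator_kernel R c h) <= eps.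
    by rewrite -ler_sqr ?nnegrE ?nrm_ge0// ltW.
  set W := indicator_kernel R c h in Eh.
  have WFG : ip mu2 W (tensor (F n) (F n)) @[n --> U] --> ip mu2 W (tensor G G).
    rewrite ip_step_tensor//; under eq_fun do rewrite ip_step_tensor//.
    apply: cvg_finite_sum => k; apply: cvg_finite_sum => l.
    apply: cvgM; first exact: cvg_cst.
    by apply: cvgM; apply: FG; exact: L2_ind.
  have WG : ip mu2 W (tensor G G) <= eps * (lam^-1 + 1).
    rewrite -(cvg_lim (@Rhausdorff R) WFG); apply: limr_le; first exact: cvgP WFG.
    have : \forall n \near \oo, eps^-1 <= n%:R by exact: nbhs_infty_ger.
    move=> /oU; apply: filterS => n en.
    have n0 : 0 < n%:R :> R by apply: lt_le_trans en; rewrite invr_gt0.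
    have qn : edge_energy (F n) <= eps.
      apply: le_trans (edge_energy_indic_le mS (f2 n) (f0 n)) _.
      rewrite -(ler_pM2l n0); apply: le_trans (fq n) _.
      by rewrite -ler_pdivrMr// mul1r.
    have := edge_energy_near h mc (F2 n); rewrite ler_norml => /andP[+ _].
    have : nrm mu2 (\1_E - W) * ip mu (F n) (F n) <= eps * lam^-1.
      apply: ler_pM; rewrite ?nrm_ge0 ?ip_ge0//.
      exact: le_trans (ip_mul_indic_le mS (f2 n)) (fb n).
    rewrite -/W; lra.
  have := edge_energy_near h mc G2; rewrite ler_norml => /andP[_].
  have : nrm mu2 (\1_E - W) * ip mu G G <= eps * ip mu G G.
    by rewrite ler_wpM2r ?ip_ge0.
  rewrite -/W; lra.
have ES0 := edge_energy_eq0 mS g2 G0.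
have S0 : mu S != 0%E.
  by apply/eqP => S0; move: muS; rewrite S0 leNgt lam0.
have [J [mJ iJ JS]] := thick_independent_part mE Ethick mS S0 ES0.
have := le_lt_trans (alpha_ge J mJ iJ) alam; rewrite JS.
by rewrite -[X in (X < _)%E]fineK ?fin_num_measure// lte_fin ltNge muS.
Qed.

End coercivity.

(** * Empirical measures of finite samples *)

Section permutation_sums.
Variables (R : realFieldType) (r : nat).
Local Notation n := r.+2.

(** By card_perm_pair, this is also the number of permutations sending (0, 1) to
    any other pair of distinct points. *)
Definition fixing_count : nat := #|[pred s : 'S_n | (s 0 == 0) && (s 1 == 1)]|.

Lemma card_perm_pair (i j : 'I_n) : i != j ->
  #|[pred s : 'S_n | (s 0 == i) && (s 1 == j)]| = fixing_count.
Proof.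
move=> ij.
(* Translation by a permutation carrying (0, 1) to (i, j). *)
have [t [t0 t1]] : exists t : 'S_n, t 0 = i /\ t 1 = j.
  pose x := tperm 0 i (1 : 'I_n).
  have xi : x != i by rewrite /x -[X in _ != X](tpermL 0 i) (inj_eq perm_inj).
  exists (tperm 0 i * tperm x j)%g; rewrite !permM tpermL -/x tpermL tpermD//.
  by rewrite eq_sym.
rewrite /fixing_count -!sum1_card (reindex_inj (@mulIg _ t))/=.
apply: eq_bigl => s; rewrite !inE !permM -t0 -t1.
by rewrite !(inj_eq perm_inj).
Qed.

Lemma sum_perm_pair (F : 'I_n -> 'I_n -> R) :
  \sum_(s : 'S_n) F (s 0) (s 1) =
  fixing_count%:R * \sum_i \sum_(j | j != i) F i j.
Proof.
rewrite (partition_big (fun s : 'S_n => s 0) predT)//= mulr_sumr.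
apply: eq_bigr => i _; rewrite mulr_sumr.
rewrite (partition_big (fun s : 'S_n => s 1) (fun j => j != i))/=; last first.
  by move=> s /eqP <-; rewrite (inj_eq perm_inj).
apply: eq_bigr => j ji; rewrite (eq_bigr (fun=> F i j)).
  by rewrite sumr_const -(card_perm_pair (i := i) (j := j)) 1?eq_sym// mulr_natl.
by move=> s /andP[/eqP -> /eqP ->].
Qed.

End permutation_sums.

Section empirical.
Context d (V : measurableType d) (R : realType).
Variable mu : {finite_measure set V -> \bar R}.
Local Notation mu2 := (square_measure mu).
Variables (I : finType) (c : V -> I) (h : rel I).
Hypothesis mc : step_map c.
Variables (lam M del : R).
Hypotheses (lam0 : 0 <= lam) (M0 : 0 <= M).
Local Notation mass := (mass mu c).
Local Notation W := (indicator_kernel R c h).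

Definition certificate_matrix k l : R :=
  lam * ((k == l)%:R / mass k) - 1 + M * (h k l)%:R.

Definition certificate : V * V -> R := step_kernel c certificate_matrix.

(** Upper bound for the diagonal entries of the certificate matrix, which are
    absent from T_r K and have to be subtracted from the quadratic form. *)
Definition certificate_diag_bound : R := (\sum_k lam / mass k) + M.

Hypothesis coercive : forall a : I -> R, (forall k, 0 <= a k) ->
  ip mu (a \o c) 1 = 1 ->
  1 + del <= lam * ip mu (a \o c) (a \o c) +
             M * ip mu2 W (tensor (a \o c) (a \o c)).

Section sample.
Variables (n : nat) (kappa : 'I_n.+1 -> I).
Hypothesis kappa0 : forall i, mass (kappa i) != 0.

Let count k : R := \sum_i (kappa i == k)%:R.

Let sum_count (F : I -> R) : \sum_i F (kappa i) = \sum_k count k * F k.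
Proof.
under [RHS]eq_bigr do rewrite mulr_suml.
rewrite exchange_big/=; apply: eq_bigr => i _.
rewrite (bigD1 (kappa i))//= eqxx mul1r big1 ?addr0// => k.
by rewrite eq_sym => /negbTE->; rewrite mul0r.
Qed.

Let count_null k : mass k = 0 -> count k = 0.
Proof.
move=> mk; rewrite /count big1// => i _; case: eqVneq => // ik.
by have := kappa0 i; rewrite ik mk eqxx.
Qed.

Let count_ge0 k : 0 <= count k.
Proof. by apply: sumr_ge0 => i _; rewrite ler0n. Qed.

Let n0 : 0 < n.+1%:R :> R. Proof. by rewrite ltr0n. Qed.

(* The density, constant on cells, giving the cells the masses they have under
   the empirical measure of the sample. *)
Let a k := count k / (n.+1%:R * mass k).

Let a_mass k : a k * mass k = count k / n.+1%:R.
Proof.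
have [mk|mk] := eqVneq (mass k) 0; first by rewrite mk mulr0 count_null// mul0r.
by rewrite /a; field; rewrite mk gt_eqF.
Qed.

Let a_sum : ip mu (a \o c) 1 = 1.
Proof.
rewrite (_ : 1 = (fun=> 1) \o c)// ip_step_fun//.
under eq_bigr do rewrite mulr1 a_mass.
rewrite -mulr_suml (_ : \sum_k count k = n.+1%:R) ?divff ?gt_eqF//.
have := sum_count (fun=> 1); rewrite sumr_const card_ord => ->.
by apply: eq_bigr => k _; rewrite mulr1.
Qed.

Let ip_a_ind k : ip mu (a \o c) (ind R c k) = count k / n.+1%:R.
Proof.
have -> : ind R c k = (fun l => (l == k)%:R) \o c.
  by apply/funext => x; rewrite indE.
rewrite ip_step_fun// (bigD1 k)//= eqxx mulr1 a_mass big1 ?addr0//.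
by move=> l /negbTE ->; rewrite mulr0 mul0r.
Qed.

(** The full double sum over a sample is the quadratic form of the certificate at
    the empirical density a, scaled by the squared sample size. *)
Lemma certificate_sum : n.+1%:R ^+ 2 * del <=
  \sum_i \sum_j certificate_matrix (kappa i) (kappa j).
Proof.
have := coercive (a := a).
have -> : ip mu (a \o c) (a \o c) = (\sum_k count k ^+ 2 / mass k) / n.+1%:R ^+ 2.
  rewrite mulr_suml ip_step_fun//; apply: eq_bigr => k _.
  have [mk|mk] := eqVneq (mass k) 0; first by rewrite mk invr0 !mulr0 mul0r.
  by rewrite -mulrA a_mass /a; field; rewrite mk gt_eqF.
have -> : ip mu2 W (tensor (a \o c) (a \o c)) =
    (\sum_k \sum_l (h k l)%:R * (count k * count l)) / n.+1%:R ^+ 2.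
  rewrite mulr_suml ip_step_tensor ?L2_step_fun//; apply: eq_bigr => k _.
  rewrite mulr_suml; by apply: eq_bigr => l _; rewrite !ip_a_ind; field; rewrite gt_eqF.
move=> H.
have a0 k : 0 <= a k by rewrite divr_ge0// mulr_ge0 ?mass_ge0// ltW.
have {H} := H a0 a_sum.
rewrite !mulrA -mulrDl ler_pdivlMr ?exprn_gt0// => H.
have -> : \sum_i \sum_j certificate_matrix (kappa i) (kappa j) =
    lam * (\sum_k count k ^+ 2 / mass k) - n.+1%:R ^+ 2 +
    M * (\sum_k \sum_l (h k l)%:R * (count k * count l)).
  under eq_bigr do rewrite (sum_count (certificate_matrix _)).
  rewrite (sum_count (fun k => \sum_l count l * certificate_matrix k l)).
  have -> : n.+1%:R ^+ 2 = \sum_k \sum_l count k * count l.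
    under eq_bigr do rewrite -mulr_sumr.
    rewrite -mulr_suml -expr2; congr (_ ^+ 2).
    have := sum_count (fun=> 1); rewrite sumr_const card_ord => ->.
    by apply: eq_bigr => k _; rewrite mulr1.
  rewrite !mulr_sumr -sumrB -big_split/=; apply: eq_bigr => k _.
  rewrite !mulr_sumr.
  have -> : lam * (count k ^+ 2 / mass k) =
      \sum_l lam * (count k * count l * ((k == l)%:R / mass k)).
    rewrite (bigD1 k)//= eqxx big1 ?addr0; first by rewrite mul1r expr2 mulrA.
    by move=> l; rewrite eq_sym => /negbTE->; rewrite mul0r !mulr0.
  rewrite -sumrB -big_split/=; apply: eq_bigr => l _.
  by rewrite /certificate_matrix; ring.
move: H; lra.
Qed.

Lemma certificate_offdiag : certificate_diag_bound <= n.+1%:R * del ->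
  0 <= \sum_i \sum_(j | j != i) certificate_matrix (kappa i) (kappa j).
Proof.
move=> Bn; have sumE : \sum_i \sum_j certificate_matrix (kappa i) (kappa j) =
    \sum_i certificate_matrix (kappa i) (kappa i) +
    \sum_i \sum_(j | j != i) certificate_matrix (kappa i) (kappa j).
  by rewrite -big_split/=; apply: eq_bigr => i _; rewrite (bigD1 i).
have diag : \sum_i certificate_matrix (kappa i) (kappa i) <=
    n.+1%:R * certificate_diag_bound.
  rewrite -[n.+1 in leRHS]card_ord mulr_natl -sumr_const; apply: ler_sum => i _.
  rewrite /certificate_matrix eqxx mul1r /certificate_diag_bound.
  have : lam / mass (kappa i) <= \sum_k lam / mass k.
    rewrite (bigD1 (kappa i))//= lerDl; apply: sumr_ge0 => k _.
    by rewrite divr_ge0// mass_ge0.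
  have : M * (h (kappa i) (kappa i))%:R <= M.
    by case: (h _ _); rewrite ?mulr1// mulr0.
  lra.
have tot := certificate_sum; rewrite sumE in tot.
have : n.+1%:R * certificate_diag_bound <= n.+1%:R ^+ 2 * del.
  by rewrite expr2 -mulrA ler_wpM2l// ltW.
lra.
Qed.

End sample.

(** T_r K averages K over ordered pairs of distinct sample points. *)
Lemma certificate_T_op r (v : r.+2.-tuple V) :
  (forall i, mass (c (tnth v i)) != 0) ->
  certificate_diag_bound <= r.+2%:R * del -> 0 <= T_op certificate v.
Proof.
move=> v0 Br; rewrite /T_op mulr_ge0 ?invr_ge0//.
rewrite (sum_perm_pair (fun i j => certificate (tnth v i, tnth v j))).
by rewrite mulr_ge0//; exact: (certificate_offdiag v0 Br).
Qed.

End empirical.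

(** * Power measures *)

Section cons_measure.
Context d (V : measurableType d) (R : realType).
Variable mu : {finite_measure set V -> \bar R}.
Variables (n : nat) (m : {finite_measure set (n.-tuple V) -> \bar R}).
Local Open Scope ereal_scope.

Definition cons_tuple (p : V * n.-tuple V) : n.+1.-tuple V := [tuple of p.1 :: p.2].

Lemma measurable_cons_tuple : measurable_fun setT cons_tuple.
Proof.
by apply: (@measurable_cons _ _ _ _ fst _ snd); [exact: measurable_fst|exact: measurable_snd].
Qed.

Definition cons_measure : set (n.+1.-tuple V) -> \bar R :=
  pushforward (mu \x m) cons_tuple.

Let cons_measure0 : cons_measure set0 = 0.
Proof. by rewrite /cons_measure /pushforward preimage_set0 measure0. Qed.

Let cons_measure_ge0 X : 0 <= cons_measure X.
Proof. by rewrite /cons_measure /pushforward. Qed.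

Let cons_measure_sigma_additive : semi_sigma_additive cons_measure.
Proof.
refine (@measure_semi_sigma_additive _ _ _ (pushforward (mu \x m) cons_tuple)).
exact: measurable_cons_tuple.
Qed.

HB.instance Definition _ := isMeasure.Build _ _ _ cons_measure
  cons_measure0 cons_measure_ge0 cons_measure_sigma_additive.

Let cons_measure_fin : fin_num_fun cons_measure.
Proof.
apply: lty_fin_num_fun; rewrite /= /cons_measure /pushforward preimage_setT -setXTT.
rewrite [ltLHS](product_measure1E _ _ measurableT measurableT).
by rewrite ltey_eq fin_numM// fin_num_measure.
Qed.

HB.instance Definition _ :=
  Measure_isFinite.Build _ _ _ cons_measure cons_measure_fin.

End cons_measure.

Section power_measure.
Context d (V : measurableType d) (R : realType).
Variable mu : {finite_measure set V -> \bar R}.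

Definition box n (B : 'I_n -> set V) : set (n.-tuple V) :=
  [set v | forall i, B i (tnth v i)].

Lemma measurable_box n (B : 'I_n -> set V) : (forall i, measurable (B i)) ->
  measurable (box B).
Proof.
move=> mB; rewrite (_ : box B = \bigcap_(i in [set: 'I_n]) ((@tnth n V)^~ i @^-1` B i)).
  apply: fin_bigcap_measurable => // i _; rewrite -[_ @^-1` _]setTI.
  by apply: measurable_tnth => //; exact: mB.
by apply/seteqP; split=> v /= H i; [move=> _|]; exact: H.
Qed.

(** Finiteness is needed along the induction, because the product at each step is
    a measure only for a sigma-finite second factor.  The null sets
    and marginals of power measures are computed from boxes. *)
Lemma power_measure_finite n :
  {m : {finite_measure set (n.-tuple V) -> \bar R} |
    (power_measure mu (n := n) = m) /\
    forall B : 'I_n -> set V, (forall i, measurable (B i)) ->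
      m (box B) = (\prod_(i < n) fine (mu (B i)))%:E}.
Proof.
elim: n => [|n [m [mE mB]]].
  exists (@dirac _ (0.-tuple V) [tuple] R); split=> // B _.
  by rewrite big_ord0 -[LHS]/(@dirac _ (0.-tuple V) [tuple] R (box B)) diracE mem_set// => -[].
exists (cons_measure mu m); split; first by rewrite /= mE.
move=> B MB; rewrite big_ord_recl EFinM fineK ?fin_num_measure//.
pose B' i := B (lift ord0 i).
have MB' i : measurable (B' i) by exact: MB.
rewrite -(mB B' MB') -(product_measure1E mu m)//; last exact: measurable_box.
congr product_measure1; apply/seteqP; split=> -[x v] /=.
  move=> H; split; first by have := H ord0; rewrite tnth0.
  by move=> i; have := H (lift ord0 i); rewrite tnthS.
move=> [Bx Bv] i; case: (unliftP ord0 i) => [j ->|->].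
  by rewrite tnthS; exact: Bv.
by rewrite tnth0.
Qed.

End power_measure.

(** * Marginals of power measures *)

Lemma ge0_integral_mrestr d (T : measurableType d) (R : realType)
    (m : {measure set T -> \bar R}) (D : set T) (mD : measurable D) (g : T -> \bar R) :
  measurable_fun setT g -> (forall x, 0 <= g x)%E ->
  (\int[mrestr m mD]_x g x = \int[m]_(x in D) g x)%E.
Proof.
move=> mg g0.
have D0 : mrestr m mD (~` D) = 0%E by rewrite /mrestr setICl measure0.
rewrite (ge0_negligible_integral (measurableC mD) measurableT mg (fun x _ => g0 x) D0).
rewrite setTD setCK; apply: eq_measure_integral => A mA AD.
by rewrite -[LHS]/(m (A `&` D)) setIidl.
Qed.

Section pair_marginal.
Context d (V : measurableType d) (R : realType).
Variable mu : {finite_measure set V -> \bar R}.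
Local Notation mu2 := (square_measure mu).
Variables (n : nat) (m : {finite_measure set (n.-tuple V) -> \bar R}).
Hypothesis m_box : forall B : 'I_n -> set V, (forall i, measurable (B i)) ->
  m (box B) = (\prod_(i < n) fine (mu (B i)))%:E.

Lemma ae_coordinates (N : set V) : measurable N -> mu N = 0%E ->
  {ae m, forall v, forall i, ~ N (tnth v i)}.
Proof.
move=> mN N0; apply: filter_forall => i.
pose B (k : 'I_n) := if k == i then N else setT.
have MB k : measurable (B k) by rewrite /B; case: ifP.
exists (box B); split; first exact: measurable_box.
  by rewrite m_box// (bigD1 i)//= {1}/B eqxx N0 mul0r.
move=> v /= /contrapT Nv k; rewrite /B; case: eqVneq => // ->.
exact: Nv.
Qed.

Variables (i j : 'I_n) (D : set V).
Hypotheses (ij : i != j) (mD : measurable D).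
Local Notation pair := (fun v : n.-tuple V => (tnth v i, tnth v j)).

(** Mass contributed by the coordinates other than i and j. *)
Definition other_mass : R := \prod_(k < n | (k != i) && (k != j)) fine (mu D).

Lemma measurable_pair : measurable_fun setT pair.
Proof. by apply: measurable_fun_pair; exact: measurable_tnth. Qed.

Lemma other_mass_ge0 : 0 <= other_mass.
Proof. by apply: prodr_ge0 => k _; exact: fine_ge0. Qed.

Lemma pair_marginal_rectangle (B C : set V) : measurable B -> measurable C ->
  m (pair @^-1` (B `*` C) `&` box (fun=> D)) =
  (other_mass%:E * mu2 ((B `*` C) `&` (D `*` D)))%E.
Proof.
move=> mB mC.
pose F (k : 'I_n) := if k == i then B `&` D else if k == j then C `&` D else D.
have MF k : measurable (F k).
  by rewrite /F; case: ifP => _; [|case: ifP => _//]; exact: measurableI.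
have -> : pair @^-1` (B `*` C) `&` box (fun=> D) = box F.
  apply/seteqP; split=> v.
    by move=> [[/= vB vC] vD] k; rewrite /F; case: eqVneq => [->//|_]; case: eqVneq => [->|].
  move=> vF; have [vB vDi] : (B `&` D) (tnth v i) by have := vF i; rewrite /F eqxx.
  have [vC vDj] : (C `&` D) (tnth v j).
    by have := vF j; rewrite /F eq_sym (negbTE ij) eqxx.
  split=> // k; have := vF k; rewrite /F.
  by case: eqVneq => [->//|_]; case: eqVneq => [->|].
rewrite m_box// (bigD1 i)//= (bigD1 j)/=; last by rewrite eq_sym.
rewrite /F eqxx eq_sym (negbTE ij) eqxx -setXI square_measureX; try exact: measurableI.
rewrite -[mu (B `&` D)]fineK ?fin_num_measure//; last exact: measurableI.
rewrite -[mu (C `&` D)]fineK ?fin_num_measure//; last exact: measurableI.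
rewrite -!EFinM; congr EFin; rewrite mulrA mulrC; congr (_ * _).
by apply: eq_bigr => k /andP[/negbTE -> /negbTE ->].
Qed.

(** The image of the restricted power measure under v |-> (v_i, v_j) and the
    multiple of the restricted product agree on rectangles. *)
Lemma pair_marginal_integral (g : V * V -> \bar R) :
  measurable_fun setT g -> (forall p, 0 <= g p)%E ->
  (\int[m]_(v in box (fun=> D)) g (pair v) =
   other_mass%:E * \int[mu2]_(p in D `*` D) g p)%E.
Proof.
move=> mg g0; have mbox : measurable (box (fun _ : 'I_n => D)) by exact: measurable_box.
have mDD : measurable (D `*` D) by exact: measurableX.
rewrite -(ge0_integral_mrestr m mbox) //; last first.
  by apply: measurableT_comp mg _; exact: measurable_pair.
rewrite -[in RHS](ge0_integral_mrestr mu2 mDD)//.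
rewrite -(ge0_integral_mscale (mrestr mu2 mDD) measurableT (NngNum other_mass_ge0))//.
have := @ge0_integral_pushforward _ _ _ _ _ _ measurable_pair (mrestr m mbox) setT g
  measurableT mg (fun p _ => g0 p).
rewrite preimage_setT => <-.
apply: eq_measure_integral => [|mp X mX _]; first exact: measurable_pair.
pose rectangles := [set A `*` B | A in @measurable _ V & B in @measurable _ V].
apply: (measure_unique rectangles (fun=> setT)) => //.
- by rewrite measurable_prod_measurableType.
- move=> _ _ [B1 mB1 [C1 mC1 <-]] [B2 mB2 [C2 mC2 <-]]; rewrite -setXI.
  exists (B1 `&` B2); first exact: measurableI.
  by exists (C1 `&` C2) => //; exact: measurableI.
- by move=> _; exists setT => //; exists setT => //; rewrite setXTT.
- by apply/seteqP; split=> // p _; exists 0%N.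
- move=> _ [B mB [C mC <-]]; rewrite /= /pushforward /mscale /mrestr/=.
  exact: pair_marginal_rectangle.
- move=> _; rewrite /= /pushforward /mrestr preimage_setT setTI.
  by rewrite ltey_eq fin_num_measure.
Qed.

End pair_marginal.

(** * The lower bound *)

Section orthonormal_extension.
Context d (V : measurableType d) (R : realType).
Variable mu : {finite_measure set V -> \bar R}.
Local Notation L2 := (Lfun mu 2%:E).

Definition orthonormal_set (S : set (V -> R)) :=
  (forall f, S f -> f \in L2) /\ (forall f g, S f -> S g -> ip mu f g = (f == g)%:R).

(** Zorn's lemma, applied to the sets S such that S together with u is
    orthonormal; this form also covers the empty chain. *)
Lemma orthonormal_basis_extension (u : V -> R) : u \in L2 -> ip mu u u = 1 ->
  exists (J : choiceType) (e : J -> V -> R) (j0 : J),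
    orthonormal_basis mu e /\ e j0 = u.
Proof.
move=> u2 uu.
have [F Fchain|A [AP Amax]] := @Zorn_bigcup (V -> R)
    [set S | orthonormal_set (S `|` [set u])].
  move=> Ftot; have common f g : (\bigcup_(X in F) X `|` [set u]) f ->
      (\bigcup_(X in F) X `|` [set u]) g ->
      (exists2 X, F X & (X `|` [set u]) f /\ (X `|` [set u]) g) \/ (f = u /\ g = u).
    move=> [[X FX Xf]|->] [[Y FY Yg]|->].
    - have [XY|YX] := Ftot _ _ FX FY; left.
      + by exists Y => //; split; left => //; exact: XY.
      + by exists X => //; split; left => //; exact: YX.
    - by left; exists X => //; split; [left|right].
    - by left; exists Y => //; split; [right|left].
    - by right.
  split=> [f Sf|f g Sf Sg].
    have [[X FX [Xf _]]|[-> _]//] := common f f Sf Sf.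
    by have [+ _] := Fchain X FX; apply.
  have [[X FX [Xf Xg]]|[-> ->]] := common f g Sf Sg.
    by have [_ +] := Fchain X FX; apply.
  by rewrite uu eqxx.
set S := A `|` [set u] in AP *; have [S2 So] := AP.
have uS : u \in S by rewrite inE; right.
exists (set_type S), (fun j => val j), (exist _ u uS); split=> //.
split=> [j|i j|f f2 fo].
- by apply: S2; exact: set_valP.
- by rewrite -[LHS]/(ip mu (val i) (val j)) So ?val_eqE//; exact: set_valP.
apply: (@ip_eq0 _ _ _ mu) => //; apply: contrapT => /eqP ff0.
have ff : 0 < ip mu f f by rewrite lt_def ff0 ip_ge0.
have nf : nrm mu f != 0 by rewrite gt_eqF// sqrtr_gt0.
pose w := (nrm mu f)^-1 *: f; have w2 : w \in L2 by exact: L2Z.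
have ww : ip mu w w = 1.
  by rewrite ipZl// ipZr// -nrm_sqr; field.
have wS g : S g -> ip mu w g = 0.
  move=> Sg; have gS : g \in S by rewrite inE.
  have fg : ip mu f g = 0 := fo (exist _ g gS).
  by rewrite /w (ipZl _ f2 (S2 _ Sg)) fg mulr0.
have nSw : ~ S w by move=> Sw; have := wS _ Sw; rewrite ww => /eqP; rewrite oner_eq0.
apply: (Amax (A `|` [set w])).
  split; first by move=> g Ag; left.
  by move=> H; apply: nSw; left; apply: H; right.
have AwE : A `|` [set w] `|` [set u] = S `|` [set w] by rewrite setUAC.
rewrite /= AwE; split=> [g [Sg|->//]|g h].
  exact: S2.
move=> [Sg|->] [Sh|->].
- exact: So.
- rewrite ipC wS//; case: eqVneq => // gw; by move: nSw; rewrite -gw.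
- rewrite wS//; case: eqVneq => // hw; by move: nSw; rewrite hw.
- by rewrite ww eqxx.
Qed.

End orthonormal_extension.

Section lower_bound.
Context d (V : measurableType d) (R : realType).
Variable mu : {finite_measure set V -> \bar R}.
Local Notation mu2 := (square_measure mu).

Lemma tensor_indic (D : set V) : tensor \1_D \1_D = \1_(D `*` D) :> (V * V -> R).
Proof.
apply/funext => p; rewrite /tensor !indicE in_setX.
by case: (_ \in _); rewrite ?mul1r ?mul0r.
Qed.

(** Integrate the inequality between the symmetrized positive and negative parts
    of K over D^(r+2); each summand is a pair marginal, and the factors
    contributed by the remaining coordinates are positive. *)
Lemma C_cone_square_ge0 r (K : V * V -> R) (D : set V) : C_cone mu r K ->
  measurable D -> 0 < fine (mu D) -> 0 <= ip mu2 (tensor \1_D \1_D) K.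
Proof.
move=> [[K2 _] +] mD D0.
have [m [-> m_box]] := power_measure_finite mu r.+2 => KT.
have {}K2 : K \in Lfun mu2 2%:E by [].
have mK := L2_measurable K2.
pose Kp p : R := Num.max (K p) 0; pose Kn p : R := Num.max (- K p) 0.
have mKp : measurable_fun setT Kp by exact: measurable_funrpos.
have mKn : measurable_fun setT Kn by exact: measurable_funrneg.
have Kp0 p : 0 <= Kp p by rewrite /Kp le_max lexx orbT.
have Kn0 p : 0 <= Kn p by rewrite /Kn le_max lexx orbT.
have KE p : K p = Kp p - Kn p.
  rewrite /Kp /Kn; have /orP[h|h] := le_total 0 (K p).
    have -> : Num.max (K p) 0 = K p by exact/max_idPl.
    have -> : Num.max (- K p) 0 = 0 by apply/max_idPr; rewrite oppr_le0.
    by rewrite subr0.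
  have -> : Num.max (K p) 0 = 0 by exact/max_idPr.
  have -> : Num.max (- K p) 0 = - K p by apply/max_idPl; rewrite oppr_ge0.
  by rewrite sub0r opprK.
have Kp2 : Kp \in Lfun mu2 2%:E.
  by apply: (L2_le mKp K2) => p; rewrite ger0_norm// /Kp ge_max normr_ge0 ler_norm.
have Kn2 : Kn \in Lfun mu2 2%:E.
  apply: (L2_le mKn K2) => p; rewrite ger0_norm// /Kn ge_max normr_ge0 andbT.
  by rewrite -normrN ler_norm.
have mDD : measurable (D `*` D) by exact: measurableX.
have intD f : f \in Lfun mu2 2%:E -> mu2.-integrable (D `*` D) (EFin \o f).
  move=> f2; apply: (integrableS measurableT) => //.
  by apply/Lfun1_integrable; apply: Lfun_subset12 f2; rewrite fin_num_measure.
rewrite ipC tensor_indic ip_indic//.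
have -> : \int[mu2]_(p in D `*` D) K p =
    \int[mu2]_(p in D `*` D) Kp p - \int[mu2]_(p in D `*` D) Kn p.
  rewrite -RintegralB//; [|exact: intD..].
  by apply: eq_Rintegral => p _.
rewrite subr_ge0.
pose pr (s : 'S_r.+2) (v : r.+2.-tuple V) := (tnth v (s 0), tnth v (s 1)).
have s01 (s : 'S_r.+2) : s 0 != s 1 by rewrite (inj_eq perm_inj).
pose om := \sum_(s : 'S_r.+2) other_mass mu (s 0) (s 1) D.
have om0 : 0 < om.
  rewrite /om (bigD1 1%g)//= ltr_pwDl//.
    by apply: prodr_gt0.
  by apply: sumr_ge0 => s _; exact: other_mass_ge0.
have sumE f : f \in Lfun mu2 2%:E -> (forall p, 0 <= f p) ->
    (\int[m]_(v in box (fun=> D)) (\sum_s f (pr s v))%:E =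
     (om * \int[mu2]_(p in D `*` D) f p)%:E)%E.
  move=> f2 f0; have mf : measurable_fun setT (EFin \o f).
    by apply/measurable_EFinP; exact: L2_measurable f2.
  under eq_integral do rewrite -sumEFin.
  have mpr s : measurable_fun setT (fun v => (f (pr s v))%:E).
    by apply: measurableT_comp mf _; exact: measurable_pair.
  rewrite ge0_integral_sum//; last 3 first.
  - by apply: measurable_box.
  - by move=> s; exact: measurable_funTS.
  - by move=> s v _; rewrite lee_fin.
  rewrite /om mulr_suml -sumEFin; apply: eq_bigr => s _.
  rewrite (pair_marginal_integral m_box (s01 s) mD mf) ?EFinM//.
  by rewrite fineK// integrable_fin_num//; exact: intD.
rewrite -(ler_pM2l om0) -lee_fin -!sumE//.
have msum f : f \in Lfun mu2 2%:E -> measurable_fun setT (fun v => (\sum_s f (pr s v))%:E).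
  move=> f2; apply/measurable_EFinP; apply: measurable_sum => s.
  by apply: measurableT_comp (L2_measurable f2) _; exact: measurable_pair.
apply: ae_ge0_le_integral.
- exact: measurable_box.
- by move=> v _; rewrite lee_fin sumr_ge0.
- by apply: measurable_funTS; exact: msum.
- by move=> v _; rewrite lee_fin sumr_ge0.
- by apply: measurable_funTS; exact: msum.
apply: filterS KT => v + _; rewrite lee_fin /T_op pmulr_rge0 ?invr_gt0 ?ltr0n ?fact_gt0//.
under eq_bigr do rewrite KE.
by rewrite sumrB subr_ge0.
Qed.

(** The witness is 1_D (x) 1_D / mu(D). *)
Lemma theta_ge_independent r (E : set (V * V)) (D : set V) :
  measurable D -> independent_set E D -> 0 < fine (mu D) ->
  (mu D <= theta mu E (dual_cone mu (C_cone mu r)))%E.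
Proof.
move=> mD iD D0; set a := fine (mu D) in D0 *.
have D2 : (\1_D : V -> R) \in Lfun mu 2%:E by exact: L2_indic.
have DD : ip mu \1_D \1_D = a by rewrite ip_indic_indic// setIid.
pose A : V * V -> R := a^-1 *: tensor \1_D \1_D.
have A2 : A \in Lfun mu2 2%:E by apply: L2Z; exact: L2_tensor.
have Aff f g : f \in Lfun mu 2%:E -> g \in Lfun mu 2%:E ->
    ip mu2 A (tensor f g) = a^-1 * (ip mu \1_D f * ip mu \1_D g).
  by move=> f2 g2; rewrite ipZl ?L2_tensor// ip_tensor.
apply: ereal_sup_ubound; exists A; last first.
  rewrite -[inner2 _ _ _]/(ip mu2 A 1).
  have -> : (1 : V * V -> R) = tensor 1 1 by apply/funext => p; rewrite /tensor mulr1.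
  have -> : mu D = a%:E by rewrite fineK ?fin_num_measure.
  have one2 : (1 : V -> R) \in Lfun mu 2%:E by exact: L2_cst1.
  have D1 : ip mu \1_D 1 = a.
    by rewrite -DD; apply: eq_Rintegral => x _; rewrite indicE; case: (_ \in _); rewrite ?mulr1 ?mul0r.
  by rewrite Aff// !D1; congr EFin; field; rewrite gt_eqF.
split.
- split.
    split=> //; apply/nearW => p.
    by rewrite /A !fctE /tensor/= [in RHS]mulrC.
  move=> K CK; rewrite -[inner2 _ _ _]/(ip mu2 A K).
  have K2 : K \in Lfun mu2 2%:E by case: CK => -[].
  rewrite ipZl ?L2_tensor// mulr_ge0 ?invr_ge0 ?(ltW D0)//.
  exact: C_cone_square_ge0 CK mD D0.
- move=> f f2; rewrite -[inner2 _ _ _]/(ip mu2 A (tensor f f)) Aff//.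
  by rewrite mulr_ge0 ?invr_ge0 ?(ltW D0)// -expr2 sqr_ge0.
- pose u : V -> R := (Num.sqrt a)^-1 *: \1_D.
  have u2 : u \in Lfun mu 2%:E by exact: L2Z.
  have sa : Num.sqrt a ^+ 2 = a by rewrite sqr_sqrtr// ltW.
  have sa0 : Num.sqrt a != 0 by rewrite gt_eqF// sqrtr_gt0.
  have uu : ip mu u u = 1 by rewrite ipZl// ipZr// DD -{3}sa; field.
  have [J [e [j0 [eB ej0]]]] := orthonormal_basis_extension u2 uu.
  exists J, e; split=> //; have [e2 eo _] := eB.
  have diag j : inner2 mu A (tensor (e j) (e j)) = (j \in [set j0])%:R.
    rewrite -[LHS]/(ip mu2 A (tensor (e j) (e j))) Aff//.
    have -> : ip mu \1_D (e j) = Num.sqrt a * ip mu u (e j).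
      by rewrite ipZl// mulrA divff// mul1r.
    rewrite -ej0 -[ip _ _ _]/(inner mu (e j0) (e j)) eo in_set1 eq_sym.
    rewrite -{1}sa; case: (_ == _); rewrite ?mulr0//=; by field.
  under eq_esum => j _ do rewrite diag.
  rewrite (_ : (fun j => _) = fun j => if j \in [set j0] then 1%E else 0%E); last first.
    by apply/funext => j; case: (_ \in _).
  by rewrite -esum_mkcond esum_set1.
- exists A; first exact/nearW.
  move=> [x y] Exy; rewrite /A !fctE tensor_indic indicE memNset ?mulr0//.
  by rewrite [LHS]mulr0.
  by move=> [/= Dx Dy]; exact: iD Dx Dy Exy.
Qed.

End lower_bound.

(** * The upper bound and the limit *)

Section upper_bound.
Context d (V : measurableType d) (R : realType).
Variable mu : {finite_measure set V -> \bar R}.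
Local Notation mu2 := (square_measure mu).
Variable E : set (V * V).

Section certificate.
Variables (I : finType) (c : V -> I) (h : rel I) (lam M del : R).
Hypotheses (mc : step_map c) (hsym : symmetric h) (lam0 : 0 <= lam) (M0 : 0 <= M).
Local Notation W := (indicator_kernel R c h).
Hypothesis coercive : forall a : I -> R, (forall k, 0 <= a k) ->
  ip mu (a \o c) 1 = 1 ->
  1 + del <= lam * ip mu (a \o c) (a \o c) +
             M * ip mu2 W (tensor (a \o c) (a \o c)).

(** A density cannot charge a null cell; the samples meeting one form a null set
    of the power measure. *)
Lemma certificate_C_cone r :
  certificate_diag_bound mu c lam M <= r.+2%:R * del ->
  C_cone mu r (certificate mu c h lam M).
Proof.
move=> Br; split.
  split; first exact: (L2_step_kernel mu mc).
  apply/nearW => p; rewrite /certificate /step_kernel/= /certificate_matrix hsym.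
  by rewrite eq_sym; case: eqVneq => [->//|_]; rewrite !mul0r.
have [m [-> m_box]] := power_measure_finite mu r.+2.
pose N := [set x | mass mu c (c x) = 0].
have NE : \1_N = (fun k => (mass mu c k == 0)%:R) \o c :> (V -> R).
  apply/funext => x; rewrite indicE /=; congr (nat_of_bool _)%:R.
  by apply/idP/eqP; rewrite inE.
have mN : measurable N.
  rewrite -[N]setTI (_ : N = (mass mu c \o c) @^-1` [set 0])//.
  by apply: (L2_measurable (L2_step_fun mu mc (mass mu c))).
have N0 : mu N = 0%E.
  rewrite -[mu N]fineK ?fin_num_measure// -[N]setIid -ip_indic_indic// NE ip_step_fun//.
  by rewrite big1// => k _; case: eqVneq => [->|_]; rewrite ?mulr0// !mul0r.
have := ae_coordinates m_box mN N0; apply: filterS => v vN.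
apply: (certificate_T_op mc lam0 M0 coercive) Br => i; apply/eqP => ci.
exact: (vN i).
Qed.

End certificate.

Lemma ip_ae_zero_on (A : V * V -> R) : measurable E -> A \in Lfun mu2 2%:E ->
  (exists2 B : V * V -> R, {ae mu2, forall p, A p = B p} & forall p, E p -> B p = 0) ->
  ip mu2 A \1_E = 0.
Proof.
move=> mE A2 [B AB BE]; rewrite -(ip0l mu2 \1_E); congr fine; apply: ae_eq_integral => //.
- exact: measurable_int (L2_mul_integrable A2 (L2_indic mu2 mE)).
- apply/measurable_EFinP; apply: measurable_funM; first exact: measurable_cst.
  exact: measurable_indic.
apply: filterS AB => p Ap _; rewrite indicE; have [pE|_] := boolP (p \in E).
  by rewrite Ap BE ?mul0r//; exact: set_mem.
by rewrite !mulr0.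
Qed.

Lemma ip_certificate (I : finType) (c : V -> I) (h : rel I) lam M (A : V * V -> R) :
  step_map c -> A \in Lfun mu2 2%:E ->
  ip mu2 A (certificate mu c h lam M) =
  lam * (\sum_k kform mu A (ind R c k) (ind R c k) / mass mu c k) - ip mu2 A 1 +
  M * ip mu2 A (indicator_kernel R c h).
Proof.
move=> mc A2.
pose Z := step_kernel c (fun k l => (k == l)%:R / mass mu c k).
have Z2 : Z \in Lfun mu2 2%:E by exact: L2_step_kernel.
have W2 := L2_indicator_kernel mu h mc.
have one2 : (1 : V * V -> R) \in Lfun mu2 2%:E by exact: (L2_cst1 mu2).
have -> : certificate mu c h lam M = (lam *: Z - 1) + M *: indicator_kernel R c h by [].
rewrite ipDr ?L2Z ?L2B ?L2Z// ipBr ?L2Z// !ipZr//; congr (_ * _ - _ + _).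
rewrite ip_step_kernel//; apply: eq_bigr => k _.
rewrite (bigD1 k)//= eqxx div1r mulrC big1 ?addr0// => l.
by rewrite eq_sym => /negbTE->; rewrite !mul0r.
Qed.

Lemma coercive_gain (l l' M del x en w e : R) :
  2 * del <= (l - l') * x -> e <= del -> M * en - M * w <= e ->
  1 <= l' * x + M * en -> 1 + del <= l * x + M * w.
Proof. by rewrite mulrBl; lra. Qed.

Lemma independence_number_le : (independence_number mu E <= mu setT)%E.
Proof.
apply: ge_ereal_sup => _ [D [mD _] <-].
by apply: le_measure; rewrite ?inE.
Qed.

Lemma independence_number_fin_num : (0 < independence_number mu E)%E ->
  independence_number mu E \is a fin_num.
Proof.
move=> alpha0; rewrite ge0_fin_numE ?(ltW alpha0)//.
by apply: le_lt_trans independence_number_le _; rewrite ltey_eq fin_num_measure.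
Qed.

(** The certificate is taken with levels alpha < l' < l < lam: l' for coercivity,
    l - l' for the gain del that absorbs the diagonal, and lam - l for the error
    M <A, W>. *)
Lemma theta_eventually_le (lam : R) : measurable_graph E -> thick mu E ->
  (0 < independence_number mu E)%E -> (independence_number mu E < lam%:E)%E ->
  exists r0, forall r, (r0 <= r)%N ->
    (theta mu E (dual_cone mu (C_cone mu r)) <= lam%:E)%E.
Proof.
move=> [mE Esym _] Ethick alpha0 alam.
have afin := independence_number_fin_num alpha0.
pose a := fine (independence_number mu E).
have aE : independence_number mu E = a%:E by rewrite fineK.
have a0 : 0 < a by rewrite -lte_fin -aE.
have alam' : a < lam by rewrite -lte_fin -aE.
pose m0 := fine (mu setT).
have m00 : 0 < m0.
  apply: lt_le_trans a0 _; rewrite -lee_fin -aE fineK ?fin_num_measure//.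
  exact: independence_number_le.
pose l' := a + (lam - a) / 3; pose l := a + (lam - a) / 3 * 2.
have al' : a < l' by rewrite /l'; lra.
have l'l : l' < l by rewrite /l' /l; lra.
have llam : l < lam by rewrite /l; lra.
have l'0 : 0 < l' by apply: lt_trans al'.
have l0 : 0 < l by apply: lt_trans l'l.
have al'E : (independence_number mu E < l'%:E)%E by rewrite aE lte_fin.
have [M M0 coer] := coercivity mE Ethick al'E.
pose del := (l - l') / (2 * m0).
have del0 : 0 < del by rewrite divr_gt0 ?subr_gt0// mulr_gt0.
pose eps := Num.min ((lam - l) / (M + 1)) (l' * del / (M + 1)).
have M1 : 0 < M + 1 by rewrite ltr_wpDl.
have eps0 : 0 < eps.
  by rewrite lt_min !divr_gt0 ?subr_gt0// mulr_gt0.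
have Meps1 : M * eps <= lam - l.
  have : (M + 1) * eps <= lam - l by rewrite mulrC -ler_pdivlMr// ge_min lexx.
  by have := ltW eps0; lra.
have Meps2 : M * eps <= l' * del.
  have : (M + 1) * eps <= l' * del by rewrite mulrC -ler_pdivlMr// ge_min lexx orbT.
  by have := ltW eps0; lra.
have [I [c [h [mc hsym Eh]]]] := symmetric_rectangle_approximation mu mE Esym eps0.
set W := indicator_kernel R c h in Eh.
have one2 : (1 : V -> R) \in Lfun mu 2%:E by exact: L2_cst1.
have coercive (b : I -> R) : (forall k, 0 <= b k) -> ip mu (b \o c) 1 = 1 ->
    1 + del <= l * ip mu (b \o c) (b \o c) + M * ip mu2 W (tensor (b \o c) (b \o c)).
  move=> b0; set f := b \o c => f1.
  have f2 : f \in Lfun mu 2%:E by exact: L2_step_fun.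
  have f0 x : 0 <= f x by exact: b0.
  set nf := ip mu f f; have nf0 : 0 <= nf by exact: ip_ge0.
  have Xm : 1 <= nf * m0.
    have := cauchy_schwarz f2 one2; rewrite f1 expr1n; congr (_ <= _ * _).
    rewrite /ip /m0 -[RHS]mul1r -(Rintegral_cst mu)//.
    by apply: eq_Rintegral => x _; rewrite mulr1.
  (* ||f||^2 >= 1 / mu(V), so raising l' to l gains at least 2 del. *)
  have gain : 2 * del <= (l - l') * nf.
    have -> : 2 * del = (l - l') / m0 by rewrite /del; field; rewrite gt_eqF.
    by rewrite ler_pdivrMr// -mulrA ler_peMr// subr_ge0 ltW.
  have Wf0 : 0 <= ip mu2 W (tensor f f).
    by apply: Rintegral_ge0 => p _; rewrite mulr_ge0 ?mulr_ge0.
  (* A large norm suffices by itself; a bounded norm makes W interchangeable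
     with E up to del. *)
  have [big|small] := leP 1 (l' * nf).
    have : 0 <= M * ip mu2 W (tensor f f) by rewrite mulr_ge0.
    by move: gain; rewrite mulrBl; have := ltW del0; lra.
  have := edge_energy_near mE h mc f2; rewrite -/W -/nf ler_norml => /andP[_ near].
  have e1 : M * (nrm mu2 (\1_E - W) * nf) <= del.
    apply: (@le_trans _ _ (M * eps * nf)); first by rewrite -mulrA ler_wpM2l// ler_wpM2r.
    apply: (@le_trans _ _ (l' * del * nf)); first by rewrite ler_wpM2r.
    by rewrite mulrAC ler_piMl ?ltW.
  have e2 : M * edge_energy mu E f - M * ip mu2 W (tensor f f) <=
      M * (nrm mu2 (\1_E - W) * nf) by rewrite -mulrBr ler_wpM2l.
  exact: coercive_gain gain e1 e2 (coer f f2 f0 f1).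
exists (Num.trunc (certificate_diag_bound mu c l M / del)).+1 => r r0r.
have Br : certificate_diag_bound mu c l M <= r.+2%:R * del.
  rewrite -ler_pdivrMr//; apply: le_trans (ltW (truncnS_gt _)) _.
  by rewrite ler_nat; exact: leq_trans r0r (leq_trans (leqnSn _) (leqnSn _)).
apply: ge_ereal_sup => _ [A [[A2s Adual] Apsd Atr AB] <-].
have [A2 Asym] : A \in Lfun mu2 2%:E /\ {ae mu2, forall p, A p = A (p.2, p.1)} by [].
have := Adual _ (certificate_C_cone mc hsym (ltW l0) M0 coercive Br).
rewrite -[inner2 _ _ _]/(ip mu2 A (certificate mu c h l M)) ip_certificate//.
rewrite lee_fin -[inner2 _ _ _]/(ip mu2 A 1).
have := trace_cells A2 Asym Apsd Atr mc.
have := indicator_kernel_bound A2 Asym Apsd Atr h mE mc.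
rewrite ipBr//; [|exact: L2_indic|exact: L2_indicator_kernel].
rewrite (ip_ae_zero_on mE A2 AB) sub0r normrN mul1r -/W => /(le_trans (ler_norm _)) AW.
move=> trc cert.
have s1 : l * (\sum_k kform mu A (ind R c k) (ind R c k) / mass mu c k) <= l.
  by rewrite -[leRHS]mulr1 ler_wpM2l// ltW.
have s2 : M * ip mu2 A W <= M * eps by rewrite ler_wpM2l//; exact: le_trans AW Eh.
move: cert s1 s2 Meps1; rewrite -/W; lra.
Qed.

End upper_bound.

Unset Implicit Arguments.
Set Strict Implicit.

Theorem theorem5p3 (R : realType) (d : measure_display) (V : measurableType d)
    (mu : {finite_measure set V -> \bar R}) (E : set (V * V))
    (hV : countably_generated V) (hE : measurable_graph E)
    (halpha : (0 < independence_number mu E)%E) (hthick : thick mu E) :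
  theta mu E (dual_cone mu (C_cone mu r)) @[r --> \oo]
    --> independence_number mu E.
Proof.
have afin := independence_number_fin_num halpha.
have lower r : (independence_number mu E <= theta mu E (dual_cone mu (C_cone mu r)))%E.
  have indep D : measurable D -> independent_set E D -> (0 < mu D)%E ->
      (mu D <= theta mu E (dual_cone mu (C_cone mu r)))%E.
    move=> mD iD D0; apply: theta_ge_independent => //.
    by rewrite fine_gt0// D0/= ltey_eq fin_num_measure.
  have [_ [D0 [mD0 iD0] <-] D0pos] := ereal_sup_gt halpha.
  apply: ge_ereal_sup => _ [D [mD iD] <-].
  have [D_pos|D_null] := ltP 0%E (mu D); first exact: indep.
  by apply: le_trans D_null _; apply: le_trans (ltW D0pos) _; exact: indep.
rewrite -(fineK afin); set a := fine _.
have upper (eps : R) : 0 < eps -> \forall r \near \oo,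
    (theta mu E (dual_cone mu (C_cone mu r)) <= (a + eps)%:E)%E.
  move=> eps0; have alam : (independence_number mu E < (a + eps)%:E)%E.
    by rewrite -(fineK afin) lte_fin ltrDl.
  have [r0 r0P] := theta_eventually_le hE hthick halpha alam.
  by exists r0 => // r /= /r0P.
have fin r (b : R) : (theta mu E (dual_cone mu (C_cone mu r)) <= b%:E)%E ->
    theta mu E (dual_cone mu (C_cone mu r)) \is a fin_num.
  move=> thb; rewrite ge0_fin_numE; first exact: le_lt_trans thb (ltry _).
  exact: le_trans (ltW halpha) (lower r).
apply/fine_cvgP; split; first by apply: filterS (upper 1 ltr01) => r /fin.
apply/cvgrPdist_le => eps eps0; apply: filterS (upper eps eps0) => r thr.
have thf := fin r _ thr.
have low := lower r; move: thr low; rewrite -(fineK thf) -(fineK afin) !lee_fin -/a.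
rewrite /= distrC => thr low; rewrite ger0_norm ?subr_ge0//.
by rewrite lerBlDl.
Qed.
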